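(* The class of inner anodyne maps of simplicial sets has the right cancellation property: for all monomorphisms of simplicial sets $i\colon A\to B$ and $j\colon B\to C$, if $i$ and $ji$ are inner anodyne, then $j$ is inner anodyne.
   Context: A map of simplicial sets is inner anodyne if it belongs to the saturated class of monomorphisms generated by the inner horn inclusions $\Lambda^n_k\subset\Delta^n$, $0<k<n$. A class $\mathcal{A}$ of monomorphisms of simplicial sets has the right cancellation property if, for all monomorphisms $i\colon A\to B$ and $j\colon B\to C$, $i, ji\in\mathcal{A}$ implies $j\in\mathcal{A}$. *)

(* Defs.v *)
From HB Require Import structures.
From mathcomp Require Import all_boot.
From mathcomp Require Import wochoice.

Set Implicit Arguments.
Unset Strict Implicit.
Unset Printing Implicit Defensive.

(* The category Delta: the object [n] = {0 < ... < n} is represented by n. *)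

Definition monotone m n (a : {ffun 'I_m.+1 -> 'I_n.+1}) : bool :=
  [forall i : 'I_m.+1, forall j : 'I_m.+1, (i <= j) ==> (a i <= a j)].

Record dhom m n := DHom {
  dfun :> {ffun 'I_m.+1 -> 'I_n.+1};
  dfun_mono : monotone dfun
}.

HB.instance Definition _ m n := [isSub for @dfun m n].
HB.instance Definition _ m n := [Finite of dhom m n by <:].

Lemma monotoneP m n (a : {ffun 'I_m.+1 -> 'I_n.+1}) :
  reflect (forall i j : 'I_m.+1, i <= j -> a i <= a j) (monotone a).
Proof.
by apply: (iffP 'forall_forallP) => h i j; [apply/implyP | apply/implyP/h].
Qed.

Lemma did_mono n : monotone [ffun i : 'I_n.+1 => i].
Proof. by apply/monotoneP => i j; rewrite !ffunE. Qed.

Definition did n : dhom n n := DHom (did_mono n).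

Lemma dcomp_mono m n p (b : dhom n p) (a : dhom m n) :
  monotone [ffun i => b (a i)].
Proof.
apply/monotoneP => i j ij; rewrite !ffunE.
exact/(monotoneP _ (dfun_mono b))/(monotoneP _ (dfun_mono a)).
Qed.

Definition dcomp m n p (b : dhom n p) (a : dhom m n) : dhom m p :=
  DHom (dcomp_mono b a).

Lemma dcompA m n p q (c : dhom p q) (b : dhom n p) (a : dhom m n) :
  dcomp c (dcomp b a) = dcomp (dcomp c b) a.
Proof. by apply/val_inj/ffunP => i; rewrite !ffunE. Qed.

Lemma dcomp1 m n (a : dhom m n) : dcomp a (did m) = a.
Proof. by apply/val_inj/ffunP => i; rewrite !ffunE. Qed.

(* One fixed universe of small types, used both for the sets of simplices and
   for the index sets of transfinite compositions. *)
Definition small := Type.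

Record sset := SSet {
  simplices :> nat -> small;
  act : forall m n, dhom m n -> simplices n -> simplices m;
  act1 : forall n (x : simplices n), act (did n) x = x;
  actM : forall m n p (b : dhom n p) (a : dhom m n) (x : simplices p),
    act (dcomp b a) x = act a (act b x)
}.

Record smap (X Y : sset) := SMap {
  sfun :> forall n, X n -> Y n;
  sfun_act : forall m n (a : dhom m n) (x : X n),
    sfun (act a x) = act a (sfun x)
}.

Definition sid (X : sset) : smap X X :=
  @SMap X X (fun _ x => x) (fun _ _ _ _ => erefl).

Lemma scomp_act (X Y Z : sset) (g : smap Y Z) (f : smap X Y) m n
    (a : dhom m n) (x : X n) :
  g _ (f _ (act a x)) = act a (g _ (f _ x)).
Proof. by rewrite !sfun_act. Qed.

Definition scomp (X Y Z : sset) (g : smap Y Z) (f : smap X Y) : smap X Z :=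
  @SMap X Z (fun n x => g n (f n x)) (scomp_act g f).

Definition mono (X Y : sset) (f : smap X Y) : Prop :=
  forall (Z : sset) (u v : smap Z X), scomp f u = scomp f v -> u = v.

Definition simplex (n : nat) : sset :=
  @SSet (fun m => dhom m n) (fun _ _ a x => dcomp x a)
    (fun _ x => dcomp1 x) (fun _ _ _ b a x => dcompA x b a).

(* An m-simplex of Delta^n lies in the horn iff it lies on the face opposite
   to some vertex i != k, i.e., iff it misses that vertex. *)
Definition in_horn n (k : 'I_n.+1) m (a : dhom m n) : bool :=
  [exists i : 'I_n.+1, (i != k) && [forall j, a j != i]].

Definition horn_simplices n (k : 'I_n.+1) m := {a : dhom m n | in_horn k a}.

Lemma in_horn_act n (k : 'I_n.+1) m p (a : dhom m p) (x : dhom p n) :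
  in_horn k x -> in_horn k (dcomp x a).
Proof.
case/existsP => i /andP[ik /forallP xi]; apply/existsP; exists i.
by rewrite ik; apply/forallP => j; rewrite ffunE.
Qed.

Definition horn_act n (k : 'I_n.+1) m p (a : dhom m p)
    (x : horn_simplices k p) : horn_simplices k m :=
  exist _ (dcomp (sval x) a) (in_horn_act a (svalP x)).

Lemma horn_act1 n (k : 'I_n.+1) m (x : horn_simplices k m) :
  horn_act (did m) x = x.
Proof. by apply/val_inj; rewrite /= dcomp1. Qed.

Lemma horn_actM n (k : 'I_n.+1) m p q (b : dhom p q) (a : dhom m p)
    (x : horn_simplices k q) :
  horn_act (dcomp b a) x = horn_act a (horn_act b x).
Proof. by apply/val_inj; rewrite /= dcompA. Qed.

Definition horn n (k : 'I_n.+1) : sset :=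
  SSet (@horn_act1 n k) (@horn_actM n k).

Definition horn_incl n (k : 'I_n.+1) : smap (horn k) (simplex n) :=
  @SMap (horn k) (simplex n) (fun m x => sval x) (fun _ _ _ _ => erefl).

(* f' is a pushout of f along u:

      A --u--> A'
      |        |
      f        f'
      v        v
      B --u'-> B'                                                         *)
Definition is_pushout (A B A' B' : sset) (f : smap A B) (u : smap A A')
    (f' : smap A' B') (u' : smap B B') : Prop :=
  scomp u' f = scomp f' u /\
  forall (Z : sset) (p : smap A' Z) (q : smap B Z),
    scomp q f = scomp p u ->
    exists! h : smap B' Z, scomp h f' = p /\ scomp h u' = q.

Definition is_retract (A B X Y : sset) (f : smap A B) (g : smap X Y) : Prop :=
  exists (s : smap A X) (r : smap X A) (s' : smap B Y) (r' : smap Y B),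
    [/\ scomp r s = sid A, scomp r' s' = sid B,
        scomp g s = scomp s' f & scomp f r = scomp r' g].

Section Transfinite.
Variables (I : small) (R : rel I).

Definition strict : rel I := [rel i j | R i j && ~~ R j i].

Lemma strictW i j : strict i j -> R i j.
Proof. by case/andP. Qed.

Definition is_bottom (o : I) : Prop := forall i, R o i.

Definition is_succ (i j : I) : Prop :=
  strict i j /\ forall k, strict k j -> R k i.

Definition is_limit (i : I) : Prop :=
  (exists j, strict j i) /\
  forall j, strict j i -> exists2 k, strict j k & strict k i.

Record diagram := Diagram {
  dobj :> I -> sset;
  darr : forall i j, R i j -> smap (dobj i) (dobj j);
  darr1 : forall i (r : R i i), darr r = sid (dobj i);
  darrM : forall i j k (r : R i j) (s : R j k) (t : R i k),
    darr t = scomp (darr s) (darr r)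
}.

Definition is_cocone (D : diagram) (P : pred I) (X : sset)
    (c : forall i, P i -> smap (D i) X) : Prop :=
  forall i j (p : P i) (q : P j) (r : R i j), scomp (c j q) (darr D r) = c i p.

Definition is_colimit (D : diagram) (P : pred I) (X : sset)
    (c : forall i, P i -> smap (D i) X) : Prop :=
  is_cocone c /\
  forall (Z : sset) (d : forall i, P i -> smap (D i) Z), is_cocone d ->
    exists! h : smap X Z, forall i (p : P i), scomp h (c i p) = d i p.

Definition continuous (D : diagram) : Prop :=
  forall i, is_limit i ->
    @is_colimit D (fun j => strict j i) (D i) (fun j p => darr D (strictW p)).

End Transfinite.

Definition map_class := forall X Y : sset, smap X Y -> Prop.

(* Isomorphisms are transfinite compositions indexed by a one-point order, and
   binary composites are indexed by a three-point order. *)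
Record saturated (S : map_class) : Prop := Saturated {
  saturated_mono : forall (X Y : sset) (f : smap X Y), S X Y f -> mono f;
  saturated_pushout : forall (A B A' B' : sset) (f : smap A B) (u : smap A A')
      (f' : smap A' B') (u' : smap B B'),
    is_pushout f u f' u' -> S A B f -> S A' B' f';
  saturated_retract : forall (A B X Y : sset) (f : smap A B) (g : smap X Y),
    is_retract f g -> S X Y g -> S A B f;
  saturated_transfinite : forall (I : small) (R : rel I) (D : diagram R)
      (o : I) (Y : sset) (c : forall i, smap (D i) Y),
    well_order R -> is_bottom R o -> continuous D ->
    (forall i j (r : R i j), is_succ R i j -> S (D i) (D j) (darr D r)) ->
    @is_colimit I R D xpredT Y (fun i _ => c i) ->
    S (D o) Y (c o)
}.

Definition contains_inner_horns (S : map_class) : Prop :=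
  forall n (k : 'I_n.+1), 0 < k < n -> S (horn k) (simplex n) (horn_incl k).

Definition inner_anodyne (X Y : sset) (f : smap X Y) : Prop :=
  forall S : map_class, saturated S -> contains_inner_horns S -> S X Y f.

(* Main.v *)
From HB Require Import structures.
From mathcomp Require Import all_boot.
From mathcomp Require Import boolp wochoice zify.
Require Import Defs.

Set Implicit Arguments.
Unset Strict Implicit.
Unset Printing Implicit Defensive.

(** The idea is to write [j] as a retract of an explicit inner anodyne map
    [B -> W], where [W] is a collapsed cylinder on [C].

    Simplices of [W] are pairs [(c, l)] of a simplex of [C] and a level
    [l : [p] -> [1]], so that [W] is a quotient of the product of [C] with the
    1-simplex.  Two kinds of pairs [(c, l)] are identified with [(c, 1)]: those
    with [c] in [A], and those whose [c] is degenerate along the vertices of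
    level 0, meaning that it factors through the map [crush l] which sends all
    of these vertices to the first one.  The map [b |-> (j b, 1)] from [B] to
    [W], together with the inclusion [c |-> (c, 1)] and the projection of [W]
    onto [C], exhibits [j] as a retract, so only [B -> W] has to be treated.
    It is a composite of three inclusions.

    - Adding all [(c, 0)] is a pushout of [j i] ([S_cyl_top]).  Inner anodyne
      maps are surjective on vertices ([vertS_saturated], [vertS_horn]), hence
      [(c, 0)] is identified with [(c, 1)] exactly when [c] lies in [A].
    - Adding all [(j b, l)] is a pushout of the Leibniz product of [i] with the
      two ends of the cylinder.  That product is inner anodyne because the maps
      for which it lies in a given saturated class again form a saturated class
      ([leibS_saturated]), which contains the inner horns ([leibS_horn]).
    - The rest is filled over the nondegenerate [n]-simplices [x] of [C] outside
      [B], by increasing [n] ([fill_anodyne]).  The prism on [x] consists of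
      [n + 1] simplices of dimension [n + 1], the [i]-th running through the
      vertices [0 .. i] on level 0 and then [i .. n] on level 1.  In decreasing
      order of [i] each of them is attached along the horn with free face [i].
      For [i = 0] this would be an outer horn, but that simplex has a single
      vertex on level 0 up to repetition, so it is collapsed: this is the reason
      for the second identification in [W].

    Both explicit fillings go through one criterion, [horn_filtration]: an
    inclusion is inner anodyne when the missing simplices can be listed, by
    increasing rank, as new simplices together with one new inner face each. *)

(** * Monotone maps and simplicial maps *)

Local Notation "x @@ a" := (act a x) (at level 40, left associativity).

Lemma dhom_mono m n (a : dhom m n) (i j : 'I_m.+1) : i <= j -> a i <= a j.
Proof. exact/(monotoneP _ (dfun_mono a)). Qed.

Lemma dhom_ext m n (a b : dhom m n) : (forall i, a i = b i) -> a = b.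
Proof. by move=> ab; apply/val_inj/ffunP. Qed.

Lemma dcompE m n p (b : dhom n p) (a : dhom m n) i : dcomp b a i = b (a i).
Proof. by rewrite ffunE. Qed.

Lemma didE n i : did n i = i.
Proof. by rewrite ffunE. Qed.

Lemma dmk_mono m n (f : 'I_m.+1 -> 'I_n.+1) :
  {homo f : i j / i <= j} -> monotone (finfun f).
Proof. by move=> fm; apply/monotoneP => i j ij; rewrite !ffunE fm. Qed.

Definition dmk m n (f : 'I_m.+1 -> 'I_n.+1) (fm : {homo f : i j / i <= j}) :
  dhom m n := DHom (dmk_mono fm).

Lemma dmkE m n (f : 'I_m.+1 -> 'I_n.+1) fm i : @dmk m n f fm i = f i.
Proof. by rewrite ffunE. Qed.

Lemma smap_ext (X Y : sset) (f g : smap X Y) :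
  (forall n x, f n x = g n x) -> f = g.
Proof.
case: f g => [f fa] [g ga] /= fg.
have e : f = g by apply: functional_extensionality_dep => n; apply: funext.
by case: _ / e ga => ga; rewrite (Prop_irrelevance fa ga).
Qed.

Lemma smap_eq (X Y : sset) (f g : smap X Y) : 
  f = g -> forall n x, f n x = g n x.
Proof. by move->. Qed.

(** Replaces case distinctions in the construction of maps out of a colimit:
    it suffices to describe the values by a functional relation. *)
Lemma smap_of_rel (X Z : sset) (G : forall n, X n -> Z n -> Prop) :
  (forall n x, exists! z, G n x z) ->
  (forall m n (a : dhom m n) x z, G n x z -> G m (x @@ a) (z @@ a)) ->
  exists h : smap X Z, forall n x, G n x (h n x).
Proof.
move=> Gf Ga.
pose h n x :=
  sval (cid (ex_intro (fun z => G n x z) _ (projT2 (cid (Gf n x))).1)).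
have hG n x : G n x (h n x) by exact: svalP.
have ha m n (a : dhom m n) x : h m (x @@ a) = h n x @@ a.
  have [z [_ zu]] := Gf m (x @@ a).
  by rewrite -(zu _ (hG _ _)) -(zu _ (Ga _ _ _ _ _ (hG n x))).
by exists (SMap ha).
Qed.

Definition yon (X : sset) n (x : X n) : smap (simplex n) X :=
  @SMap (simplex n) X (fun m (a : dhom m n) => x @@ a)
    (fun m p a b => actM b a x).

(** Two simplices with the same image give two maps from a standard simplex
    with the same composite. *)
Lemma mono_inj (X Y : sset) (f : smap X Y) :
  mono f -> forall n, injective (f n).
Proof.
move=> fm n x y fxy.
have /fm/smap_eq/(_ n (did n)) : scomp f (yon x) = scomp f (yon y).
  by apply: smap_ext => m a /=; rewrite !sfun_act fxy.
by rewrite /= !act1.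
Qed.

(** * Predicates as maps *)

(** The object representing predicates: maps from [X] to [pred_sset n] are the
    predicates on [X n].  Universal properties can thus be tested on predicates:
    existence of mediating maps extends them, uniqueness identifies them. *)
Definition pred_sset (n : nat) : sset.
Proof.
refine (@SSet (fun m => dhom n m -> Prop)
          (fun m p a phi c => phi (dcomp a c)) _ _).
- move=> m phi; apply: funext => c; congr phi.
  by apply: dhom_ext => i; rewrite dcompE didE.
- by move=> m p q b a phi; apply: funext => c; rewrite dcompA.
Defined.

Definition pred_map (X : sset) n (P : X n -> Prop) : smap X (pred_sset n).
Proof.
refine (@SMap X (pred_sset n) (fun m x c => P (x @@ c)) _).
by move=> m p a x; apply: funext => c /=; rewrite -actM.
Defined.

Definition pred_of_map (X : sset) n (h : smap X (pred_sset n)) (x : X n) :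
  Prop :=
  h n x (did n).

Lemma pred_of_map_comp (X Y : sset) n (h : smap Y (pred_sset n)) (f : smap X Y)
    (P : X n -> Prop) :
  scomp h f = pred_map P -> forall x, pred_of_map h (f n x) <-> P x.
Proof.
move=> e x; have /= := smap_eq e x; rewrite /pred_of_map => ->.
by rewrite /= act1.
Qed.

Lemma pred_map_comp (X Y : sset) n (P : Y n -> Prop) (f : smap X Y) :
  scomp (pred_map P) f = pred_map (fun x => P (f n x)).
Proof.
by apply: smap_ext => m x; apply: funext => c /=; rewrite sfun_act.
Qed.

Lemma pred_map_ext (X : sset) n (P Q : X n -> Prop) :
  (forall x, P x <-> Q x) -> pred_map P = pred_map Q.
Proof. by move=> PQ; congr pred_map; apply: funext => x; apply: propext. Qed.

Lemma pred_map_inj (X : sset) n (P Q : X n -> Prop) x :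
  pred_map P = pred_map Q -> P x <-> Q x.
Proof.
move=> e; have /= := smap_eq e x.
by move=> /(congr1 (fun g => g (did n))); rewrite act1 => ->.
Qed.

(** * Pushouts, simplex by simplex *)

Section PushoutFacts.
Variables (A B A' B' : sset) (f : smap A B) (u : smap A A').
Variables (f' : smap A' B') (u' : smap B B').
Hypothesis po : is_pushout f u f' u'.

Lemma pushout_comm n a : u' n (f n a) = f' n (u n a).
Proof. exact: smap_eq po.1 n a. Qed.

Lemma pushout_pred n (P : A' n -> Prop) (Q : B n -> Prop) :
  (forall a, Q (f n a) <-> P (u n a)) ->
  exists H : B' n -> Prop,
    (forall a, H (f' n a) <-> P a) /\ (forall b, H (u' n b) <-> Q b).
Proof.
move=> PQ; have [|h [[hf hu] _]] := po.2 _ (pred_map P) (pred_map Q).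
  by rewrite !pred_map_comp; apply: pred_map_ext.
by exists (pred_of_map h); split; apply: pred_of_map_comp.
Qed.

(** Being in one of the two images and being anything at all are predicates
    that agree after restriction along both maps, so they are equal. *)
Lemma pushout_cover n (y : B' n) :
  (exists a, y = f' n a) \/ (exists b, y = u' n b).
Proof.
pose T m (Z : sset) := fun _ : Z m => True.
have [|h [_ hU]] := po.2 _ (pred_map (@T n A')) (pred_map (@T n B)).
  by rewrite !pred_map_comp; apply: pred_map_ext.
pose P (y : B' n) := (exists a, y = f' n a) \/ (exists b, y = u' n b).
have hT : h = pred_map (@T n B').
  by apply: hU; rewrite !pred_map_comp; split; apply: pred_map_ext.
have hP : h = pred_map P.
  apply: hU; rewrite !pred_map_comp; split; apply: pred_map_ext => x; split=> // _.
  - by left; exists x.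
  - by right; exists x.
by apply: (pred_map_inj y (etrans (esym hT) hP)).1.
Qed.

(** Extend to [B'] the predicate that is true on [A'] and is the image of [f]
    on [B]. *)
Lemma pushout_im n b a : u' n b = f' n a -> exists x, b = f n x.
Proof.
move=> e.
have [|H [Hf Hu]] := @pushout_pred n (fun=> True) (fun b => exists x, b = f n x).
  by move=> x; split=> // _; exists x.
by apply/(Hu b); rewrite e; apply/Hf.
Qed.

(** Outside the image of [f], the predicate of being equal to [b] extends to
    [B'] by false on [A']. *)
Lemma pushout_inj n b b' : u' n b = u' n b' -> b = b' \/ exists x, b = f n x.
Proof.
move=> e; have [|nf] := EM (exists x, b = f n x); first by right.
have [|H [Hf Hu]] := @pushout_pred n (fun=> False) (fun y => y = b).
  by move=> a; split=> // ab; apply: nf; exists a.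
by left; apply/esym/(Hu b'); rewrite -e; apply/Hu.
Qed.

End PushoutFacts.

(** A map out of [B'] is glued from its values on the images of [f'] and [u'],
    which overlap only in the image of [A]. *)
Lemma is_pushoutP (A B A' B' : sset) (f : smap A B) (u : smap A A')
    (f' : smap A' B') (u' : smap B B') :
  (forall n a, u' n (f n a) = f' n (u n a)) ->
  (forall n, injective (f' n)) ->
  (forall n y, (exists a, y = f' n a) \/ (exists b, y = u' n b)) ->
  (forall n b a, u' n b = f' n a -> exists x, b = f n x) ->
  (forall n b b', u' n b = u' n b' -> b = b' \/ exists a, u' n b = f' n a) ->
  is_pushout f u f' u'.
Proof.
move=> comm finj cover image inj; split; first exact: smap_ext.
move=> Z p q /smap_eq /= qp.
pose G n (y : B' n) (z : Z n) :=
  (exists2 a, y = f' n a & z = p n a) \/ (exists2 b, y = u' n b & z = q n b).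
have pq n b a : u' n b = f' n a -> q n b = p n a.
  move=> e; have [x bx] := image _ _ _ e.
  by move: e; rewrite bx comm => /finj <-; exact: qp.
have Guniq n y z z' : G n y z -> G n y z' -> z = z'.
  case=> [[a -> ->]|[b -> ->]] [[a' e ->]|[b' e ->]].
  - by rewrite (finj _ _ _ e).
  - by rewrite (pq _ _ _ (esym e)).
  - exact: pq.
  - case: (inj _ _ _ e) => [->//|[a ea]].
    by rewrite (pq _ _ _ ea) (pq n b' a) // -e.
have Gex n y : exists z, G n y z.
  have [[a ->]|[b ->]] := cover n y.
  - by exists (p n a); left; exists a.
  - by exists (q n b); right; exists b.
have [||h hG] := @smap_of_rel B' Z G.
- by move=> n y; have [z Gz] := Gex n y; exists z; split=> // z'; apply: Guniq.
- move=> m n a y z [[x -> ->]|[x -> ->]].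
  + by left; exists (x @@ a); rewrite sfun_act.
  + by right; exists (x @@ a); rewrite sfun_act.
have hf n a : h n (f' n a) = p n a.
  by apply: Guniq (hG _ _) _; left; exists a.
have hu n b : h n (u' n b) = q n b.
  by apply: Guniq (hG _ _) _; right; exists b.
exists h; split; first by split; apply: smap_ext.
move=> h' [/smap_eq hf' /smap_eq hu']; apply: smap_ext => n y.
by have [[a ->]|[b ->]] := cover n y; rewrite ?hf ?hu -?hf' -?hu'.
Qed.

(** * Well orders *)

Section WellOrder.
Variables (I : Type) (R : rel I).
Hypothesis wo : well_order R.

Let pick2 x y : exists2 z, z = x \/ z = y & R z x /\ R z y.
Proof.
have [|z [[]]] := wo (A := fun z => `[< z = x \/ z = y >]).
  by exists x; apply/asboolP; left.
move=> /asboolP zxy lb _; exists z => //.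
by split; apply: lb; apply/asboolP; [left|right].
Qed.

Lemma wo_refl : reflexive R.
Proof. by move=> x; have [z [] -> []] := pick2 x x. Qed.

Lemma wo_total : total R.
Proof. by move=> x y; have [z [] -> [? ?]] := pick2 x y; apply/orP; auto. Qed.

Lemma wo_anti x y : R x y -> R y x -> x = y.
Proof.
move=> xy yx; have [|z [_ zu]] := wo (A := fun z => `[< z = x \/ z = y >]).
  by exists x; apply/asboolP; left.
have xx := wo_refl x; have yy := wo_refl y.
rewrite -(zu x) ?(zu y) //; split; try by apply/asboolP; auto.
  by move=> t /asboolP[] ->.
by move=> t /asboolP[] ->.
Qed.

Lemma wo_trans x y z : R x y -> R y z -> R x z.
Proof.
move=> xy yz.
have [|t [[]]] := wo (A := fun t => `[< [\/ t = x, t = y | t = z] >]).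
  by exists x; apply/asboolP; constructor 1.
move=> /asboolP h lb _.
have [tx ty tz] : [/\ R t x, R t y & R t z].
  split; apply: lb; apply/asboolP; [constructor 1|constructor 2|constructor 3] => //.
case: h => e; rewrite {}e in tx ty tz => //.
- by rewrite (wo_anti xy tx).
- by rewrite -(wo_anti yz ty).
Qed.

Lemma wo_strictN x y : ~~ R x y -> strict R y x.
Proof.
move=> nxy; apply/andP; split=> //.
by have := wo_total x y; rewrite (negPf nxy).
Qed.

Lemma wo_strict_neq x y : R x y -> x <> y -> strict R x y.
Proof.
move=> xy nxy; apply/andP; split=> //; apply/negP => yx.
exact/nxy/wo_anti.
Qed.

Lemma strict_irr x : ~ strict R x x.
Proof. by case/andP=> ->. Qed.

Lemma wo_strict_trans x y z : strict R x y -> R y z -> strict R x z.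
Proof.
move=> /andP[xy nyx] yz; apply/andP; split; first exact: wo_trans yz.
by apply: contra nyx; apply: wo_trans.
Qed.

Lemma wo_ind (P : I -> Prop) :
  (forall x, (forall y, strict R y x -> P y) -> P x) -> forall x, P x.
Proof.
move=> ih x; apply: contrapT => nPx.
have [|z [[]]] := wo (A := fun z => `[< ~ P z >]).
  by exists x; apply/asboolP.
move=> /asboolP nPz lb _; apply: nPz; apply: ih => y yz.
apply: contrapT => nPy; case/andP: yz => _ /negP; apply.
by apply: lb; apply/asboolP.
Qed.

Lemma wo_cases x :
  [\/ forall y, R x y, exists y, is_succ R y x | is_limit R x].
Proof.
have [b|/existsNP[w /negP xw]] := EM (forall y, R x y); first by constructor 1.
have [s|ns] := EM (exists y, is_succ R y x); first by constructor 2.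
constructor 3; split; first by exists w; apply: wo_strictN.
move=> j jx; apply: contrapT => nk; apply: ns; exists j; split=> // k kx.
apply: contrapT => /negP/wo_strictN jk; apply: nk.
by exists k.
Qed.

End WellOrder.

(** * Colimits *)

Section ColimFacts.
Variables (I : small) (R : rel I) (D : diagram R) (P : pred I) (X : sset).
Variable c : forall i, P i -> smap (D i) X.
Hypothesis col : is_colimit c.

Lemma colim_pred n (Q : forall i, D i n -> Prop) :
  (forall i j (r : R i j) x, P i -> P j -> Q j (darr D r n x) <-> Q i x) ->
  exists H : X n -> Prop, forall i (p : P i) x, H (c p n x) <-> Q i x.
Proof.
move=> Qc; have [|h [hc _]] := col.2 _ (fun i _ => pred_map (Q i)).
  by move=> i j p q r; rewrite pred_map_comp; apply: pred_map_ext => x; apply: Qc.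
by exists (pred_of_map h) => i p x; apply: pred_of_map_comp.
Qed.

Lemma colim_cover n (x : X n) : exists i (p : P i) y, x = c p n y.
Proof.
pose T (Z : sset) := fun _ : Z n => True.
have [|h [_ hU]] := col.2 _ (fun i _ => pred_map (@T (D i))).
  by move=> i j p q r; rewrite pred_map_comp; apply: pred_map_ext.
pose Q x := exists i (p : P i) y, x = c p n y.
have hT : h = pred_map (@T X).
  by apply: hU => i p; rewrite pred_map_comp; apply: pred_map_ext.
have hQ : h = pred_map Q.
  apply: hU => i p; rewrite pred_map_comp; apply: pred_map_ext => y; split=> // _.
  by exists i, p, y.
by apply: (pred_map_inj x (etrans (esym hT) hQ)).1.
Qed.

Lemma colim_comm i j (p : P i) (q : P j) (r : R i j) n x :
  c q n (darr D r n x) = c p n x.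
Proof. exact: smap_eq (col.1 _ _ p q r) n x. Qed.

Hypothesis wo : well_order R.
Hypothesis darr_inj : forall i j (r : R i j) n,
  P i -> P j -> injective (darr D r n).

Lemma darr_comp i j k (r : R i j) (s : R j k) (t : R i k) n x :
  darr D s n (darr D r n x) = darr D t n x.
Proof. by rewrite (darrM D r s t). Qed.

(** To separate [x] from [y], spread the predicate of being equal to [x] over the
    whole diagram: it holds of [d] if [d] and [x] have a common image at some
    later stage.  Injectivity of the transition maps makes this independent of
    the stage, and makes it restrict on [D i] to equality with [x]. *)
Lemma colim_inj i (p : P i) n : injective (c p n).
Proof.
move=> x y e.
pose Q k (d : D k n) := exists m (r : R k m) (s : R i m),
  P m /\ darr D r n d = darr D s n x.
have up k d m (r : R k m) (s : R i m) m' (r' : R k m') (s' : R i m') :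
    R m m' -> darr D r n d = darr D s n x -> darr D r' n d = darr D s' n x.
  by move=> mm'; rewrite -(darr_comp r mm' r') -(darr_comp s mm' s') => ->.
have down k d m (r : R k m) (s : R i m) m' (r' : R k m') (s' : R i m') :
    R m m' -> P m -> P m' ->
    darr D r' n d = darr D s' n x -> darr D r n d = darr D s n x.
  move=> mm' pm pm'; rewrite -(darr_comp r mm' r') -(darr_comp s mm' s').
  exact: darr_inj.
have [|H Hc] := @colim_pred n Q.
  move=> k k' r d pk pk'; split=> -[m [rm [s [pm em]]]].
  - exists m, (wo_trans wo r rm), s; split=> //.
    by rewrite -(darr_comp r rm).
  - have [km|mk] := orP (wo_total wo k' m).
      exists m, km, s; split=> //.
      by rewrite (darr_comp r km (wo_trans wo r km)); apply: up em; apply: wo_refl.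
    exists k', (wo_refl wo k'), (wo_trans wo s mk); split=> //.
    rewrite (darr_comp r _ (wo_trans wo rm mk)).
    exact: up em.
have Qx : Q i x by exists i, (wo_refl wo i), (wo_refl wo i).
have := (Hc i p x).2 Qx; rewrite e => /(Hc i p y).1 [m [r [s [pm em]]]].
have := @up i y m r s m s s (wo_refl wo m) em.
by move/(@darr_inj _ _ s n p pm).
Qed.

End ColimFacts.

(** * Continuous diagrams *)

Section DiagramFacts.
Variables (I : small) (R : rel I) (D : diagram R) (o : I).
Hypothesis wo : well_order R.
Hypothesis cont : continuous D.

Lemma darr_id i (r : R i i) n x : darr D r n x = x.
Proof. by rewrite darr1. Qed.

Lemma darr_injective :
  (forall i j (r : R i j), is_succ R i j -> forall n, injective (darr D r n)) ->
  forall i j (r : R i j) n, injective (darr D r n).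
Proof.
move=> si i j; elim/(wo_ind wo): j i => j ih i r n.
have [ij|ij] := EM (i = j).
  by subst i => x y; rewrite !darr_id.
have sij := wo_strict_neq wo r ij.
case: (wo_cases wo j) => [b|[k kj]|lim].
- by have := b i; case/andP: sij => _ /negP.
- have ik := kj.2 i sij; have rkj := strictW kj.1.
  move=> x y; rewrite -!(darr_comp ik rkj r) => /(si _ _ _ kj) /ih; apply.
  exact: kj.1.
- have e : darr D r = darr D (strictW sij).
    by rewrite (Prop_irrelevance (strictW sij) r).
  rewrite e; have cl := cont lim.
  refine (@colim_inj _ _ _ _ _ _ cl wo _ i sij n) => a b rab m aj bj.
  exact: ih.
Qed.

Lemma darr_vertices : is_bottom R o ->
  (forall i j (r : R i j), is_succ R i j -> forall y, exists x, y = darr D r 0 x) ->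
  forall i (r : R o i) (y : D i 0), exists x, y = darr D r 0 x.
Proof.
move=> ob si; elim/(wo_ind wo) => j ih r y.
case: (wo_cases wo j) => [b|[k kj]|lim].
- by have oj := wo_anti wo (b o) r; subst j; exists y; rewrite darr_id.
- have rkj := strictW kj.1; have [z ->] := si _ _ rkj kj y.
  have [x ->] := ih k kj.1 (ob k) z.
  by exists x; rewrite (darr_comp _ _ r).
- have [k [kj [z ->]]] := colim_cover (cont lim) y.
  have [x ->] := ih k kj (ob k) z.
  by exists x; rewrite (darr_comp _ _ r).
Qed.

End DiagramFacts.


(** * Subcomplexes *)

Record subcx (X : sset) := Subcx {
  smem :> forall n, X n -> Prop;
  smem_act : forall m n (a : dhom m n) (x : X n), smem x -> smem (x @@ a)
}.

Lemma subcx_ext (X : sset) (U V : subcx X) :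
  (forall n (x : X n), U n x <-> V n x) -> U = V.
Proof.
case: U V => [U Ua] [V Va] /= UV.
have e : U = V.
  apply: functional_extensionality_dep => n; apply: funext => x.
  exact/propext/UV.
by case: _ / e Va => Va; rewrite (Prop_irrelevance Ua Va).
Qed.

Definition full (X : sset) : subcx X :=
  @Subcx X (fun _ _ => True) (fun _ _ _ _ _ => I).

Definition empty (X : sset) : subcx X :=
  @Subcx X (fun _ _ => False) (fun _ _ _ _ h => h).

Definition image (X Y : sset) (f : smap X Y) : subcx Y.
Proof.
refine (@Subcx Y (fun n y => exists x, y = f n x) _).
by move=> m n a y [x ->]; exists (x @@ a); rewrite sfun_act.
Defined.

Definition sub (X : sset) (U : subcx X) : sset.
Proof.
refine (@SSet (fun n => {x : X n | U n x})
  (fun m n a x => exist _ (sval x @@ a) (smem_act a (svalP x))) _ _).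
- by move=> n [x ux]; apply: eq_exist; rewrite act1.
- by move=> m n p b a x; apply: eq_exist; rewrite actM.
Defined.

Lemma sub_ext (X : sset) (U : subcx X) n (x y : sub U n) :
  sval x = sval y -> x = y.
Proof. by case: x y => [x ux] [y uy] /= e; apply: eq_exist. Qed.

Definition sub_in (X : sset) (U : subcx X) : smap (sub U) X :=
  @SMap (sub U) X (fun n x => sval x) (fun _ _ _ _ => erefl).

Definition sub_lift (X Y : sset) (U : subcx Y) (f : smap X Y)
  (fU : forall n x, U n (f n x)) : smap X (sub U).
Proof.
refine (@SMap X (sub U) (fun n x => exist _ (f n x) (fU n x)) _).
by move=> m n a x; apply: eq_exist; rewrite sfun_act.
Defined.

Definition sub_map (X : sset) (U V : subcx X) (UV : forall n x, U n x -> V n x) :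
    smap (sub U) (sub V) :=
  @sub_lift (sub U) X V (sub_in U) (fun n x => UV n _ (svalP x)).

(** * Inclusions in a saturated class *)

Section Saturated.
Variable S : map_class.
Hypothesis satS : saturated S.

(** Memberships in a saturated class are reduced to inclusions of subcomplexes of
    one simplicial set, where simplices can be compared by equality. *)
Definition incl_in (X : sset) (U V : subcx X) : Prop :=
  exists UV : forall n x, U n x -> V n x, S (sub_map UV).

Lemma saturated_inj (X Y : sset) (f : smap X Y) :
  S f -> forall n, injective (f n).
Proof. by move=> /(saturated_mono satS)/mono_inj. Qed.

(** [V] arises from [U] by gluing [B] along [A]. *)
Lemma incl_in_pushout (A B X : sset) (f : smap A B) (g : smap B X)
    (U V : subcx X) :
  S f ->
  (forall n x, U n x -> V n x) ->
  (forall n b, V n (g n b)) ->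
  (forall n x, V n x -> U n x \/ exists b, x = g n b) ->
  (forall n b, U n (g n b) <-> exists a, b = f n a) ->
  (forall n b b', g n b = g n b' -> b = b' \/ U n (g n b)) ->
  incl_in U V.
Proof.
move=> Sf UV Vg cover Ug inj; exists UV.
have Ugf n a : U n (scomp g f n a) by apply/Ug; exists a.
apply: (saturated_pushout satS (u := sub_lift Ugf) (u' := sub_lift Vg) _ Sf).
apply: is_pushoutP => n.
- by move=> a; apply: sub_ext.
- by move=> x y /(congr1 sval) /= e; apply: sub_ext.
- case=> x Vx; have [Ux|[b e]] := cover n x Vx.
    by left; exists (exist _ x Ux); apply: sub_ext.
  by right; exists b; apply: sub_ext.
- by move=> b a /(congr1 sval) /= e; apply/Ug; rewrite e; apply: svalP.
- move=> b b' /(congr1 sval) /= e; have [|Ub] := inj n b b' e; first by left.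
  by right; exists (exist _ _ Ub); apply: sub_ext.
Qed.

(** A mono is a pushout of the inclusion of its image, along the inverse of its
    corestriction. *)
Lemma incl_in_mono (X Y : sset) (f : smap X Y) :
  (forall n, injective (f n)) -> incl_in (image f) (full Y) -> S f.
Proof.
move=> fi [UV Sm].
have [||u hu] := @smap_of_rel (sub (image f)) X (fun n y x => sval y = f n x).
- move=> n [y [x yx]]; exists x; split=> //= x' yx'.
  by apply: (fi n); rewrite -yx -yx'.
- by move=> m n a y x /= ->; rewrite sfun_act.
apply: (saturated_pushout satS (u := u) (u' := sub_in (full Y)) _ Sm).
apply: is_pushoutP => n.
- by move=> a /=; apply: hu.
- exact: fi.
- by move=> y; right; exists (exist _ y I).
- move=> b a /= e; have ib : image f n (sval b) by exists a.
  by exists (exist _ _ ib); apply: (@sub_ext _ (full Y)).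
- by move=> b b' /= e; left; apply: (@sub_ext _ (full Y)).
Qed.

Lemma incl_in_full (X : sset) (U : subcx X) : incl_in U (full X) -> S (sub_in U).
Proof.
move=> UX; apply: incl_in_mono; first by move=> n x y /= e; apply: sub_ext.
suff -> : image (sub_in U) = U by [].
apply: subcx_ext => n x; split=> [[y ->]|Ux]; first exact: svalP.
by exists (exist _ x Ux).
Qed.

Lemma full_incl_in (X : sset) (U : subcx X) : S (sub_in U) -> incl_in U (full X).
Proof.
move=> SU; apply: (incl_in_pushout (g := sid X) SU) => //.
- by move=> n x; right; exists x.
- move=> n x; split=> [Ux|[y e]]; first by exists (exist _ _ Ux).
  by rewrite e; apply: (svalP y).
- by move=> n x y; left.
Qed.

Section Chain.
Variables (I : small) (R : rel I) (o : I) (X : sset) (U : I -> subcx X).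
Hypothesis wo : well_order R.
Hypothesis ob : is_bottom R o.
Hypothesis Umono : forall i j, R i j -> forall n x, U i n x -> U j n x.

Definition chain_diagram : diagram R.
Proof.
refine (@Diagram I R (fun i => sub (U i)) (fun i j r => sub_map (Umono r)) _ _).
- by move=> i r; apply: smap_ext => n x; apply: sub_ext.
- by move=> i j k r s t; apply: smap_ext => n x; apply: sub_ext.
Defined.

Lemma chain_colimit (P : pred I) (V : subcx X)
    (UV : forall i, P i -> forall n x, U i n x -> V n x) :
  (forall n x, V n x -> exists2 i, P i & U i n x) ->
  @is_colimit I R chain_diagram P (sub V) (fun i p => sub_map (UV i p)).
Proof.
move=> cover; split.
  by move=> i j p q r; apply: smap_ext => n x; apply: sub_ext.
move=> Z d dc.
have dE i j (p : P i) (q : P j) n (x : sub (U i) n) (y : sub (U j) n) :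
    sval x = sval y -> d i p n x = d j q n y.
  wlog r : i j p q x y / R i j.
    move=> W e; have [r|r] := orP (wo_total wo i j); first exact: W.
    by apply/esym/W.
  move=> e; rewrite -(smap_eq (dc i j p q r) x) /=.
  by congr (d j q n _); apply: sub_ext.
pose G n (x : sub V n) (z : Z n) :=
  exists i (p : P i) (y : sub (U i) n), sval x = sval y /\ z = d i p n y.
have Gu n x z z' : G n x z -> G n x z' -> z = z'.
  move=> [i [p [y [e ->]]]] [i' [p' [y' [e' ->]]]].
  by apply: dE; rewrite -e -e'.
have [||h hG] := @smap_of_rel (sub V) Z G.
- move=> n x; have [i p Ux] := cover n _ (svalP x).
  exists (d i p n (exist _ _ Ux)); split; first by exists i, p, (exist _ _ Ux).
  by move=> z; apply: Gu; exists i, p, (exist _ _ Ux).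
- move=> m n a x z [i [p [y [e ->]]]]; exists i, p, (y @@ a).
  by rewrite /= e sfun_act.
have hd i (p : P i) n x : h n (sub_map (UV i p) n x) = d i p n x.
  by apply: Gu (hG _ _) _; exists i, p, x.
exists h; split; first by move=> i p; apply: smap_ext => n x; apply: hd.
move=> h' hd'; apply: smap_ext => n x.
have [i p Ux] := cover n _ (svalP x).
have -> : x = sub_map (UV i p) n (exist _ _ Ux) by apply: sub_ext.
by rewrite hd -(hd' i p).
Qed.

(** Transfinite composition in terms of an increasing family of subcomplexes:
    an increasing union is always the colimit of its terms, so that continuity
    only says that no simplex appears at a limit index. *)
Lemma incl_in_chain (V : subcx X) :
  (forall i j, is_succ R i j -> incl_in (U i) (U j)) ->
  (forall i, is_limit R i -> forall n x, U i n x ->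
     exists2 j, strict R j i & U j n x) ->
  (forall i n x, U i n x -> V n x) ->
  (forall n x, V n x -> exists i, U i n x) ->
  incl_in (U o) V.
Proof.
move=> succ lim UV cover; exists (UV o).
apply: (saturated_transfinite satS (D := chain_diagram)
          (c := fun i => sub_map (UV i)) wo ob).
- move=> i li /=.
  by apply: (@chain_colimit _ (U i) (fun j p => Umono (strictW p))); apply: lim.
- move=> i j r /succ [UV' SU] /=.
  by rewrite (_ : sub_map (Umono r) = sub_map UV') //; apply: smap_ext => n x;
    apply: sub_ext.
- apply: (@chain_colimit _ V (fun j p => UV j)) => n x /cover[i Ux].
  by exists i.
Qed.

End Chain.

Lemma incl_in_trans (X : sset) (U V W : subcx X) :
  incl_in U V -> incl_in V W -> incl_in U W.
Proof.
move=> [UV SUV] [VW SVW].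
have wo3 : well_order (fun i j : 'I_3 => i <= j).
  apply: antisymmetric_well_order => [i j ij|A [a Aa]].
    by apply: val_inj; apply: anti_leq.
  have [i Ai image] := @arg_minnP 'I_3 a (fun i => i \in A) val Aa.
  by exists i; split.
pose F (i : 'I_3) := nth W [:: U; V; W] i.
have FW : forall i n x, F i n x -> W n x.
  by move=> [[|[|[|m]]] hm] n x; rewrite /F //=; auto.
have mF : forall i j : 'I_3, i <= j -> forall n x, F i n x -> F j n x.
  move=> [[|[|[|i]]] hi] [[|[|[|j]]] hj] //= _ n x; rewrite /F //=; auto.
apply: (@incl_in_chain 'I_3 _ ord0 X F wo3 _ mF) => //.
- move=> [[|[|[|i]]] hi] [[|[|[|j]]] hj] //= [/= ij lt] //; rewrite /F /=.
  + by exists UV.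
  + by have := lt (Ordinal (isT : 1 < 3)) isT.
  + by exists VW.
- move=> [[|m] hi] [[j ji] lim]; first by case/andP: ji.
  have [k] := lim (Ordinal (ltnW hi)) ltac:(by rewrite /strict /= leqnSn ltnn).
  by rewrite /strict /= -!ltnNge => /andP[_ mk] /andP[_]; rewrite ltnS leqNgt mk.
- by move=> n x Wx; exists ord_max.
Qed.


(** * Attaching inner horns one at a time *)

(** The cells [c x] are attached to [U] by increasing rank, each along the horn
    with free face [k x].  Faces in the horn must be there already; all others,
    that is [c x] itself, the free face and their degeneracies, must be new and
    must not be identified with each other.  Only the rank constrains the order,
    so that cells of equal rank may be attached in any order; a well-order [R0]
    of the cells breaks the ties. *)
Section HornFiltration.
Hypothesis hornS : contains_inner_horns S.
Variables (X : sset) (U : subcx X) (J : small) (rk d : J -> nat).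
Variables (k : forall x : J, 'I_(d x).+1) (c : forall x : J, X (d x)).
Hypothesis k_inner : forall x, 0 < k x < d x.
Hypothesis horn_old : forall x m (a : dhom m (d x)), in_horn (k x) a ->
  U m (c x @@ a) \/ exists y, rk y < rk x /\ exists b, c x @@ a = c y @@ b.
Hypothesis new_U : forall x m (a : dhom m (d x)), ~~ in_horn (k x) a ->
  ~ U m (c x @@ a).
Hypothesis new_cell : forall x m (a : dhom m (d x)), ~~ in_horn (k x) a ->
  forall y (b : dhom m (d y)), rk y <= rk x -> c x @@ a = c y @@ b -> y = x.
Hypothesis new_inj : forall x m (a b : dhom m (d x)), ~~ in_horn (k x) a ->
  ~~ in_horn (k x) b -> c x @@ a = c x @@ b -> a = b.
Hypothesis cover : forall n (z : X n),
  U n z \/ exists x, exists b, z = c x @@ b.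

Section Order.
Variable R0 : rel J.
Hypothesis wo0 : well_order R0.

(** The index [None] is added on top as the stage where all cells are present. *)
Definition cell_le (s t : option J) : bool :=
  match s, t with
  | _, None => true
  | None, Some _ => false
  | Some x, Some y => (rk x < rk y) || (rk x == rk y) && R0 x y
  end.

Lemma cell_wo : well_order cell_le.
Proof.
apply: antisymmetric_well_order.
  move=> [x|] [y|] //= /andP[/orP[xy|/andP[/eqP xy Rxy]]].
    by move=> /orP[|/andP[/eqP]]; [rewrite ltnNge ltnW|move=> e; rewrite e ltnn in xy].
  by rewrite xy ltnn eqxx => /= Ryx; rewrite (wo_anti wo0 Rxy Ryx).
move=> A [t At].
have [[x Ax]|nA] := EM (exists x, Some x \in A); last first.
  case: t At => [x Ax|At]; first by case: nA; exists x.
  by exists None; split=> // -[x|] // Ax; case: nA; exists x.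
pose Q m := `[< exists2 x, Some x \in A & rk x = m >].
have exQ : exists m, Q m by exists (rk x); apply/asboolP; exists x.
case: (ex_minnP exQ) => m /asboolP[y Ay ym] mmin.
have [|z [[]]] := wo0 (A := fun z => `[< Some z \in A /\ rk z = m >]).
  by exists y; apply/asboolP.
move=> /asboolP[Az zm] lb _; exists (Some z); split=> // -[w|] //= Aw.
have mw : m <= rk w by apply: mmin; apply/asboolP; exists w.
rewrite zm; move: mw; rewrite leq_eqVlt => /orP[mw|->] //.
by rewrite mw lb ?orbT //; apply/asboolP; split=> //; apply/esym/eqP.
Qed.

Definition stage (t : option J) : subcx X.
Proof.
refine (@Subcx X (fun n z => U n z \/
  exists x, strict cell_le (Some x) t /\ exists b, z = c x @@ b) _).
move=> m n a z [Uz|[x [xt [b ->]]]]; first by left; apply: smem_act.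
by right; exists x; split=> //; exists (dcomp b a); rewrite actM.
Defined.

Lemma stage_mono s t : cell_le s t -> forall n z, stage s n z -> stage t n z.
Proof.
move=> st n z [Uz|[x [xs b]]]; first by left.
by right; exists x; split=> //; apply: (wo_strict_trans cell_wo xs st).
Qed.

(** A successor step is a pushout of the horn inclusion of the new cell. *)
Lemma stage_succ x t :
  is_succ cell_le (Some x) t -> incl_in (stage (Some x)) (stage t).
Proof.
move=> [xt tmin].
have rkx y : strict cell_le (Some y) (Some x) -> rk y <= rk x.
  by case/andP => /= /orP[/ltnW //|/andP[/eqP ->]].
have old m (a : dhom m (d x)) : in_horn (k x) a -> stage (Some x) m (c x @@ a).
  move=> /horn_old[Ua|[y [yx b]]]; [by left|right].
  exists y; split=> //; apply/andP; rewrite /= yx; split=> //.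
  by rewrite ltnNge (ltnW yx) (gtn_eqF yx).
have new m (a : dhom m (d x)) : ~~ in_horn (k x) a -> ~ stage (Some x) m (c x @@ a).
  move=> na [/new_U-/(_ na)//|[y [yx [b e]]]].
  have yx' := new_cell na (rkx _ yx) e; rewrite yx' in yx.
  by have := strict_irr yx.
apply: (@incl_in_pushout _ _ _ (horn_incl (k x)) (yon (c x))).
- exact: hornS.
- by apply: stage_mono; apply: strictW.
- by move=> m a; right; exists x; split=> //; exists a.
- move=> m z [Uz|[y [yt [b ->]]]]; first by left; left.
  have /= yx := tmin _ yt.
  have [yx'|yx'] := EM (y = x).
    by subst y; right; exists b.
  left; right; exists y; split; last by exists b.
  by apply: (wo_strict_neq cell_wo) => // -[].
- move=> m a; split=> [sa|[[h hh] ->]]; last exact: old.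
  have ha : in_horn (k x) a by apply: contraPT sa => /new.
  by exists (exist _ a ha).
- move=> m a b e; have [ha|na] := boolP (in_horn (k x) a); first by right; apply: old.
  have [hb|nb] := boolP (in_horn (k x) b).
    by case: (new _ _ na); rewrite [c x @@ a]e; apply: old.
  by left; apply: new_inj e.
Qed.

Lemma horn_filtration_wo : incl_in U (full X).
Proof.
have [|o [[_ ob] _]] := cell_wo (A := xpredT); first by exists None.
have {}ob : is_bottom cell_le o by move=> t; apply: ob.
have -> : U = stage o.
  apply: subcx_ext => n z; split=> [|[//|[x [xo]]]]; first by left.
  by have := ob (Some x); case/andP: xo => _ /negP.
apply: (incl_in_chain cell_wo ob stage_mono).
- move=> [x|] t xt; first exact: stage_succ.
  by case: xt => /andP[/=]; case: t.
- move=> t [[s st] lim] n z [Uz|[x [xt b]]].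
    by exists s => //; left.
  have [r xr rt] := lim _ xt; exists r => //.
  by right; exists x.
- by [].
- move=> n z _; exists None; have [Uz|[x b]] := cover z; [by left|right].
  by exists x.
Qed.

End Order.

Lemma horn_filtration : incl_in U (full X).
Proof.
pose J' : eqType := HB.pack J (gen_eqMixin J).
have [R0 wo0] := well_ordering_principle J'.
exact: (horn_filtration_wo (R0 := R0)).
Qed.

End HornFiltration.

End Saturated.


(** * Levels *)

(** A level on a [p]-simplex is a monotone map to [[1]]; it is determined by the
    initial segment of vertices that it sends to 0. *)
Definition low p (l : dhom p 1) (i : 'I_p.+1) : bool := l i == ord0.

Lemma lev_ext p (l l' : dhom p 1) : (forall i, low l i = low l' i) -> l = l'.
Proof.
move=> e; apply: dhom_ext => i; have := e i; rewrite /low.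
by case: (l i) (l' i) => [[|[|a]] ha] [[|[|b]] hb] //= _; apply: val_inj.
Qed.

Lemma low_le p (l : dhom p 1) (i j : 'I_p.+1) : i <= j -> low l j -> low l i.
Proof.
move=> /(dhom_mono l) ij /eqP lj; apply/eqP/val_inj/eqP.
by rewrite /= -leqn0 (leq_trans ij) // lj.
Qed.

Lemma low_comp m p (l : dhom p 1) (a : dhom m p) i :
  low (dcomp l a) i = low l (a i).
Proof. by rewrite /low dcompE. Qed.

Lemma mklev_mono p (b : pred 'I_p.+1) :
  (forall i j : 'I_p.+1, i <= j -> b j -> b i) ->
  {homo (fun i => if b i then ord0 else ord_max : 'I_2) : i j / i <= j}.
Proof.
by move=> bm i j ij; case bj: (b j); [rewrite (bm i j ij bj)|case: ifP].
Qed.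

Definition mklev p (b : pred 'I_p.+1)
    (bm : forall i j : 'I_p.+1, i <= j -> b j -> b i) :
  dhom p 1 := dmk (mklev_mono bm).

Lemma low_mklev p (b : pred 'I_p.+1) bm i : low (@mklev p b bm) i = b i.
Proof. by rewrite /low dmkE; case: (b i). Qed.

Definition bot p : dhom p 1 := @mklev p xpredT (fun _ _ _ _ => isT).
Definition top p : dhom p 1 := @mklev p xpred0 (fun _ _ _ b => b).

Lemma low_bot p i : low (bot p) i. Proof. by rewrite low_mklev. Qed.
Lemma low_top p i : low (top p) i = false. Proof. by rewrite low_mklev. Qed.

Lemma botP p (l : dhom p 1) : (forall i, low l i) -> l = bot p.
Proof. by move=> h; apply: lev_ext => i; rewrite low_bot h. Qed.

Lemma topP p (l : dhom p 1) : (forall i, ~~ low l i) -> l = top p.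
Proof. by move=> h; apply: lev_ext => i; rewrite low_top (negPf (h i)). Qed.

Lemma bot_comp m p (a : dhom m p) : dcomp (bot p) a = bot m.
Proof. by apply: botP => i; rewrite low_comp low_bot. Qed.

Lemma top_comp m p (a : dhom m p) : dcomp (top p) a = top m.
Proof. by apply: topP => i; rewrite low_comp low_top. Qed.

Lemma bot_top p : bot p <> top p.
Proof. by move=> /(congr1 (fun l => low l ord0)); rewrite low_bot low_top. Qed.

Lemma crush_mono p (l : dhom p 1) :
  {homo (fun i => if low l i then ord0 else i) : i j / i <= j}.
Proof.
move=> i j ij; case: (boolP (low l i)) => // nli.
by case: ifP => // /(low_le ij); rewrite (negPf nli).
Qed.

(** Sends the low vertices to the first vertex and fixes the others.  A simplex
    is degenerate along its low vertices iff it is fixed by [crush l], which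
    makes this condition an equation that every simplicial map preserves. *)
Definition crush p (l : dhom p 1) : dhom p p := dmk (@crush_mono p l).

Lemma crushE p (l : dhom p 1) i : crush l i = if low l i then ord0 else i.
Proof. exact: dmkE. Qed.

Lemma crush_top p : crush (top p) = did p.
Proof. by apply: dhom_ext => i; rewrite crushE low_top didE. Qed.

(** Crushing after a restriction does nothing to a simplex that was crushed
    before it; this makes [collapsed] stable under faces and degeneracies. *)
Lemma crush_comp m p (l : dhom p 1) (a : dhom m p) :
  dcomp (dcomp (crush l) a) (crush (dcomp l a)) = dcomp (crush l) a.
Proof.
apply: dhom_ext => i; rewrite !dcompE !crushE low_comp.
case: (boolP (low l (a i))) => li; last by rewrite (negPf li).
by rewrite (low_le _ li) //; apply: dhom_mono.
Qed.

Lemma comp_crush n p (g : dhom p n) (l : dhom p 1) :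
  dcomp g (crush l) = g <-> (forall i j, low l i -> low l j -> g i = g j).
Proof.
split=> [e i j li lj|h].
  by rewrite -e !dcompE !crushE li lj.
apply: dhom_ext => i; rewrite dcompE crushE; case: ifP => // li.
by apply: h => //; apply: low_le li.
Qed.

(** * The cylinder *)

Section Cylinder.
Variables (X : sset) (A : subcx X).

Definition collapsed p (c : X p) (l : dhom p 1) : Prop :=
  A p c \/ c @@ crush l = c.

Lemma collapsed_top p (c : X p) : collapsed c (top p).
Proof. by right; rewrite crush_top act1. Qed.

Lemma collapsed_act m p (a : dhom m p) (c : X p) l :
  collapsed c l -> collapsed (c @@ a) (dcomp l a).
Proof.
case=> [Ac|e]; [by left; apply: smem_act|right].
by rewrite -{1}e -!actM dcompA crush_comp actM e.
Qed.

(** The quotient is represented by normal forms: a collapsed pair is replaced by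
    the pair with the same simplex and the constant level 1. *)
Definition normal p (w : X p * dhom p 1) : Prop :=
  collapsed w.1 w.2 -> w.2 = top p.

Definition cyl_simplices p := {w : X p * dhom p 1 | normal w}.

Definition normalize p (c : X p) (l : dhom p 1) : cyl_simplices p :=
  match pselect (collapsed c l) with
  | left _ => exist (@normal p) (c, top p) (fun _ => erefl)
  | right n => exist (@normal p) (c, l) (fun h => False_ind _ (n h))
  end.

Lemma normalize_eq p (c c' : X p) l l' :
  normalize c l = normalize c' l' <->
  c = c' /\ (l = l' \/ collapsed c l /\ collapsed c l').
Proof.
split; last first.
  case=> <- [<- //|[cl cl']]; rewrite /normalize.
  by case: pselect => // h; case: pselect => // h'; apply: eq_exist.
rewrite /normalize; case: pselect => h; case: pselect => h' /(congr1 sval) /= e.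
- by case: e => <- in h' *; split=> //; right.
- by case: e => _ e; case: h'; rewrite -e; apply: collapsed_top.
- by case: e => _ e; case: h; rewrite e; apply: collapsed_top.
- by case: e => -> ->; split=> //; left.
Qed.

Lemma normalizeK p (w : cyl_simplices p) : normalize (sval w).1 (sval w).2 = w.
Proof.
case: w => [[c l] h] /=; rewrite /normalize; case: pselect => [cl|ncl].
  by apply: eq_exist; rewrite [l]h.
exact: eq_exist.
Qed.

Lemma normalize_act p (c : X p) l m (a : dhom m p) :
  normalize ((sval (normalize c l)).1 @@ a) (dcomp (sval (normalize c l)).2 a) =
  normalize (c @@ a) (dcomp l a).
Proof.
rewrite /normalize; case: (pselect (collapsed c l)) => [h|//].
apply/normalize_eq; split=> //; right; split; apply: collapsed_act => //.
exact: collapsed_top.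
Qed.

Definition cyl : sset.
Proof.
refine (@SSet cyl_simplices
  (fun m p a w => normalize ((sval w).1 @@ a) (dcomp (sval w).2 a)) _ _).
- by move=> p w; rewrite act1 dcomp1 normalizeK.
- by move=> m n p b a w; rewrite normalize_act actM dcompA.
Defined.

Definition cls p (c : X p) (l : dhom p 1) : cyl p := normalize c l.

Lemma cls_act m p (a : dhom m p) (c : X p) l :
  cls c l @@ a = cls (c @@ a) (dcomp l a).
Proof. exact: normalize_act. Qed.

Lemma cls_eq p (c c' : X p) l l' :
  cls c l = cls c' l' <-> c = c' /\ (l = l' \/ collapsed c l /\ collapsed c l').
Proof. exact: normalize_eq. Qed.

Lemma clsP p (w : cyl p) : exists c l, w = cls c l.
Proof. by exists (sval w).1, (sval w).2; rewrite /cls normalizeK. Qed.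

Definition stable (Q : forall p, X p -> dhom p 1 -> Prop) : Prop :=
  forall m p (a : dhom m p) c l, Q p c l -> Q m (c @@ a) (dcomp l a).

(** The subcomplex of classes that have some representative in [Q]. *)
Definition cyl_sub (Q : forall p, X p -> dhom p 1 -> Prop) (Qa : stable Q) :
  subcx cyl.
Proof.
refine (@Subcx cyl (fun p w => exists c l, w = cls c l /\ Q p c l) _).
move=> m p a w [c [l [-> q]]]; exists (c @@ a), (dcomp l a).
by split; [apply: cls_act|apply: Qa].
Defined.

End Cylinder.


(** * Leibniz products with the cylinder *)

Section CylMap.
Variables (X Y : sset) (A : subcx X) (A' : subcx Y) (f : smap X Y).
Hypothesis fA : forall p x, A p x -> A' p (f p x).

Lemma collapsed_map p (c : X p) l : collapsed A c l -> collapsed A' (f p c) l.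
Proof. by case=> [/fA|e]; [left|right]; rewrite -?sfun_act ?e. Qed.

Lemma cyl_map_act m p (a : dhom m p) (w : cyl A p) :
  cls A' (f m (sval (w @@ a)).1) (sval (w @@ a)).2 =
  cls A' (f p (sval w).1) (sval w).2 @@ a.
Proof.
rewrite cls_act -sfun_act /=.
have := normalize_act A (sval w).1 (sval w).2 a; rewrite normalizeK.
set c := _ @@ a; set l := dcomp _ _; move=> _.
have /normalize_eq [-> [-> //|[h h']]] := normalizeK (normalize A c l).
by apply/cls_eq; split=> //; right; split; apply: collapsed_map.
Qed.

Definition cyl_map : smap (cyl A) (cyl A') := SMap cyl_map_act.

Lemma cyl_mapE p (c : X p) l : cyl_map p (cls A c l) = cls A' (f p c) l.
Proof.
have /normalize_eq [e h] := normalizeK (normalize A c l).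
rewrite /=; apply/cls_eq; rewrite e; split=> //.
by rewrite e in h; case: h => [h|[h h']]; [left|right; split; apply: collapsed_map].
Qed.

End CylMap.

Definition leibniz_pred (X Y : sset) (f : smap X Y) p (c : Y p)
    (l : dhom p 1) : Prop :=
  [\/ image f p c, l = bot p | l = top p].

Lemma leibniz_pred_act (X Y : sset) (f : smap X Y) : stable (leibniz_pred f).
Proof.
move=> m p a c l; case=> [h|->|->]; [constructor 1|constructor 2|constructor 3].
- exact: smem_act.
- exact: bot_comp.
- exact: top_comp.
Qed.

(** The domain of the Leibniz product of [f] with the inclusion of the two ends,
    as a subcomplex of the cylinder on [Y]. *)
Definition leibniz (X Y : sset) (f : smap X Y) : subcx (cyl (empty Y)) :=
  cyl_sub (empty Y) (@leibniz_pred_act X Y f).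

Section Leibniz.
Variable S : map_class.
Hypothesis satS : saturated S.

(** Membership of [f] itself is included so that the maps of the class are known
    to be injective. *)
Definition leibS (X Y : sset) (f : smap X Y) : Prop :=
  S f /\ incl_in S (leibniz f) (full (cyl (empty Y))).

(** Pushing a Leibniz product along the cylinder of [g].  The hypotheses say that
    [g] is injective away from the image of [f], and that [Q] meets the cylinder
    on [B] in the domain of the Leibniz product.  No further identifications
    occur: if the image of [b] is fixed by [crush l] and [b] is not in the image
    of [f], then [b] is fixed by [crush l] too, by this injectivity. *)
Lemma incl_in_cyl (A B Y : sset) (f : smap A B) (g : smap B Y) (K : subcx Y)
  (Q Q' : forall p, Y p -> dhom p 1 -> Prop) (Qa : stable Q) (Qa' : stable Q') :
  leibS f ->
  (forall p b, K p (g p b) -> image f p b) ->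
  (forall p b b', g p b = g p b' -> b = b' \/ image f p b) ->
  (forall p c l, Q p c l -> Q' p c l) ->
  (forall p b l, Q' p (g p b) l) ->
  (forall p c l, Q' p c l -> Q p c l \/ image g p c) ->
  (forall p b l, Q p (g p b) l <-> leibniz_pred f b l) ->
  incl_in S (cyl_sub K Qa) (cyl_sub K Qa').
Proof.
move=> [_ /(incl_in_full satS) Sf] gK ginj QQ' gQ' cover gQ.
have cK p b l : collapsed K (g p b) l -> collapsed (empty B) b l \/ image f p b.
  case=> [/gK|]; first by right.
  rewrite -sfun_act => /esym/ginj [e|]; last by right.
  by left; right.
have inQ p b l :
    cyl_sub K Qa p (cls K (g p b) l) <-> leibniz f p (cls (empty B) b l).
  split=> [[c [l' [/cls_eq[<- e] q]]]|[b' [l' [/cls_eq[<- e] h]]]].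
    have {q} h := (gQ _ _ _).1 q; case: e => [->|[cl cl']]; first by exists b, l'.
    have [cb|fb] := cK _ _ _ cl; last by exists b, l; split=> //; constructor 1.
    exists b, (top p); split; last by constructor 3.
    by apply/cls_eq; split=> //; right; split=> //; apply: collapsed_top.
  exists (g p b), l'; split; last exact/gQ.
  apply/cls_eq; split=> //; case: e => [->|[cl cl']]; [by left|right].
  by split; apply: (collapsed_map (A := empty B)) => // ? ? [].
have gA p x : empty B p x -> K p (g p x) by [].
apply: (@incl_in_pushout _ satS _ _ _ (sub_in (leibniz f)) (cyl_map gA)) => //.
- by move=> p w [c [l [-> q]]]; exists c, l; split=> //; apply: QQ'.
- move=> p w; have [b [l ->]] := clsP w; rewrite cyl_mapE.
  by exists (g p b), l.
- move=> p w [c [l [-> /cover[q|[b ->]]]]]; first by left; exists c, l.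
  by right; exists (cls (empty B) b l); rewrite cyl_mapE.
- move=> p w; have [b [l ->]] := clsP w; rewrite cyl_mapE.
  split=> [/inQ h|[[w' h] /= e]]; first by exists (exist _ _ h).
  by apply/inQ; rewrite e.
- move=> p w w'; have [b [l ->]] := clsP w; have [b' [l' ->]] := clsP w'.
  rewrite !cyl_mapE => /cls_eq [e h].
  have [fb|nfb] := EM (image f p b).
    by right; apply/inQ; exists b, l; split=> //; constructor 1.
  have bb : b = b' by case: (ginj _ _ _ e).
  subst b'; left; apply/cls_eq; split=> //.
  case: h => [->|[cl cl']]; [by left|right].
  by split; [case: (cK _ _ _ cl)|case: (cK _ _ _ cl')].
Qed.

Lemma leibS_pushout (A B A' B' : sset) (f : smap A B) (u : smap A A')
    (f' : smap A' B') (u' : smap B B') :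
  is_pushout f u f' u' -> leibS f -> leibS f'.
Proof.
move=> po Sf; split; first exact: (saturated_pushout satS po Sf.1).
have -> : full (cyl (empty B')) =
    cyl_sub (empty B') (Q := fun _ _ _ => True) (fun _ _ _ _ _ _ => I).
  by apply: subcx_ext => n w; split=> // _; have [c [l ->]] := clsP w; exists c, l.
apply: (incl_in_cyl (g := u') _ _ Sf) => //.
- by move=> p b b'; apply: (pushout_inj po).
- move=> p c l _; have [[a ->]|] := pushout_cover po c; last by right.
  by left; constructor 1; exists a.
- move=> p b l; split=> -[[a e]|->|->]; try by [constructor 2|constructor 3].
    by constructor 1; apply: (pushout_im po e).
  by constructor 1; exists (u p a); rewrite e; apply: (pushout_comm po).
Qed.

Lemma leibS_retract (A B X Y : sset) (f : smap A B) (g : smap X Y) :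
  is_retract f g -> leibS g -> leibS f.
Proof.
move=> ret [Sg eg]; split; first exact: (saturated_retract satS ret Sg).
have [s [r [s' [r' [_ rs' gs fr]]]]] := ret.
have eA p x : empty B p x -> empty Y p (s' p x) by [].
have eX p x : empty Y p x -> empty B p (r' p x) by [].
have sL p w : leibniz f p w -> leibniz g p (cyl_map eA p w).
  move=> [c [l [-> h]]]; rewrite cyl_mapE; exists (s' p c), l; split=> //.
  case: h => [[a ->]|->|->]; [constructor 1|by constructor 2|by constructor 3].
  by exists (s p a); rewrite -[s' p _](smap_eq gs).
have rL p w : leibniz g p w -> leibniz f p (cyl_map eX p w).
  move=> [c [l [-> h]]]; rewrite cyl_mapE; exists (r' p c), l; split=> //.
  case: h => [[a ->]|->|->]; [constructor 1|by constructor 2|by constructor 3].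
  by exists (r p a); rewrite -[r' p _](smap_eq fr).
have rsw p w : cyl_map eX p (cyl_map eA p w) = w.
  have [c [l ->]] := clsP w; rewrite !cyl_mapE.
  by rewrite [r' p _](smap_eq rs').
apply: (full_incl_in satS); apply: (saturated_retract satS) (incl_in_full satS eg).
exists (@sub_lift (sub (leibniz f)) _ (leibniz g) (scomp (cyl_map eA) (sub_in _))
          (fun p x => sL p _ (svalP x))),
       (@sub_lift (sub (leibniz g)) _ (leibniz f) (scomp (cyl_map eX) (sub_in _))
          (fun p x => rL p _ (svalP x))), (cyl_map eA), (cyl_map eX).
split; apply: smap_ext => p w //; last exact: rsw.
by apply: sub_ext; apply: rsw.
Qed.

Section Transfinite.
Variables (I : small) (R : rel I) (D : diagram R) (o : I) (Y : sset).
Variable c : forall i, smap (D i) Y.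
Hypothesis wo : well_order R.
Hypothesis ob : is_bottom R o.
Hypothesis cont : continuous D.
Hypothesis col : @is_colimit I R D xpredT Y (fun i _ => c i).

(** The stages of the composition of Leibniz products are the subcomplexes of the
    cylinder on the colimit formed by its ends and by the cylinder on [D i].  That
    each step is a pushout uses injectivity of the maps [D i -> Y]. *)
Lemma leibS_transfinite :
  (forall i j (r : R i j), is_succ R i j -> leibS (darr D r)) -> leibS (c o).
Proof.
move=> succ; split.
  apply: (saturated_transfinite satS wo ob cont _ col) => i j r ij.
  exact: (succ i j r ij).1.
have dinj i j (r : R i j) n : injective (darr D r n).
  apply: (darr_injective wo cont) => i' j' r' ij.
  exact: (saturated_inj satS (succ _ _ r' ij).1).
have cinj i n : injective (c i n).
  by apply: (@colim_inj _ _ _ _ _ _ col wo _ i isT).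
have cc i j (r : R i j) n x : c j n (darr D r n x) = c i n x.
  exact: (@colim_comm _ _ _ _ _ _ col i j isT isT).
apply: (incl_in_chain satS (U := fun i => leibniz (c i)) wo ob) => //.
- move=> i j r n w [y [l [-> h]]]; exists y, l; split=> //.
  case: h => [[x ->]|->|->]; [constructor 1|by constructor 2|by constructor 3].
  by exists (darr D r n x); rewrite cc.
- move=> i j ij; have r := strictW ij.1.
  apply: (incl_in_cyl (g := c j) _ _ (succ i j r ij)) => //.
  + by move=> p b b' /cinj; left.
  + move=> p y l [[x ->]|->|->]; [constructor 1|by constructor 2|by constructor 3].
    by exists (darr D r p x); rewrite cc.
  + by move=> p b l; constructor 1; exists b.
  + by move=> p y l [|->|->]; [right|left; constructor 2|left; constructor 3].
  + move=> p b l; split=> -[[x e]|->|->]; try by [constructor 2|constructor 3].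
      by constructor 1; exists x; apply: (@cinj j); rewrite cc.
    by constructor 1; exists x; rewrite e cc.
- move=> i lim n w [y [l [-> h]]].
  case: h => [[x ->]|e|e].
  + have [j [ji [z ->]]] := colim_cover (cont lim) x.
    exists j => //; exists (c i n (darr D (strictW ji) n z)), l; split=> //.
    by constructor 1; exists z; rewrite cc.
  + have [j ji] := lim.1; exists j => //; exists y, l; split=> //.
    by constructor 2.
  + have [j ji] := lim.1; exists j => //; exists y, l; split=> //.
    by constructor 3.
- move=> n w _; have [y [l ->]] := clsP w.
  have [i [_ [x ->]]] := colim_cover col y.
  by exists i, (c i n x), l; split=> //; constructor 1; exists x.
Qed.

End Transfinite.

Lemma leibS_saturated : saturated leibS.
Proof.
split.
- by move=> X Y f [/(saturated_mono satS)].
- exact: leibS_pushout.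
- exact: leibS_retract.
- by move=> *; apply: leibS_transfinite.
Qed.

(** * Surjectivity on vertices *)

Definition vertS (X Y : sset) (f : smap X Y) : Prop :=
  S f /\ forall y : Y 0, image f 0 y.

Lemma vertS_saturated : saturated vertS.
Proof.
split.
- by move=> X Y f [/(saturated_mono satS)].
- move=> A B A' B' f u f' u' po [Sf sf]; split.
    exact: (saturated_pushout satS po Sf).
  move=> y; have [//|[b ->]] := pushout_cover po y.
  by have [a ->] := sf b; exists (u 0 a); apply: (pushout_comm po).
- move=> A B X Y f g ret [Sg sg]; split.
    exact: (saturated_retract satS ret Sg).
  have [s [r [s' [r' [_ rs' _ fr]]]]] := ret.
  move=> y; have [x e] := sg (s' 0 y); exists (r 0 x).
  have /= -> := smap_eq fr x; rewrite -e.
  exact/esym/(smap_eq rs').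
- move=> I R D o Y c wo ob cont succ col; split.
    apply: (saturated_transfinite satS wo ob cont _ col) => i j r ij.
    exact: (succ i j r ij).1.
  move=> y; have [i [_ [x ->]]] := colim_cover col y.
  have [|z ->] := @darr_vertices _ _ _ _ wo cont ob _ i (ob i) x.
    by move=> j k r jk; apply: (succ j k r jk).2.
  by exists z; apply: (@colim_comm _ _ _ _ _ _ col o i isT isT).
Qed.

Hypothesis hornS : contains_inner_horns S.

(** An inner horn has dimension at least 2, so each of its vertices lies
    on some face other than the [k]-th. *)
Lemma vertS_horn : contains_inner_horns vertS.
Proof.
move=> n k kn; split; first exact: hornS.
move=> a; have ha : in_horn k a.
  have n1 : 1 < n by case/andP: kn => k0; apply: leq_trans.
  have /subsetPn[i _ hi] : ~~ ([set: 'I_n.+1] \subset [set k; a ord0]).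
    apply/negP => /subset_leq_card; rewrite cardsT card_ord leqNgt.
    by rewrite cards2 ltnS (leq_trans _ n1) //; case: (k != _).
  move: hi; rewrite !inE negb_or => /andP[ik ia].
  apply/existsP; exists i; rewrite ik; apply/forallP => j.
  by rewrite [j]ord1 eq_sym.
by exists (exist _ a ha).
Qed.

End Leibniz.


(** * The Leibniz product of an inner horn *)

Lemma hornN_hit n (k : 'I_n.+1) m (a : dhom m n) : ~~ in_horn k a ->
  forall t, t < n.+1 -> t <> k -> exists x, a x = t :> nat.
Proof.
move=> na t tn tk; apply: contrapT => nx; case/negP: na.
apply/existsP; exists (Ordinal tn); apply/andP; split.
  exact/eqP/(contra_not _ tk)/(congr1 val).
by apply/forallP => x; apply/eqP => ax; apply: nx; exists x; rewrite ax.
Qed.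

Lemma horn_miss n (k : 'I_n.+1) m (a : dhom m n) t :
  t < n.+1 -> t <> k -> (forall x, a x <> t :> nat) -> in_horn k a.
Proof.
move=> tn tk h; apply: contraT => /hornN_hit/(_ t tn tk)[x].
by move/h.
Qed.

Lemma horn_missed n (k : 'I_n.+1) m (a : dhom m n) : in_horn k a ->
  exists t, [/\ t < n.+1, t <> k & forall x, a x <> t :> nat].
Proof.
move=> /existsP[t /andP[/eqP tk /forallP at_]]; exists t; split.
- exact: ltn_ord.
- by move=> e; apply/tk/ord_inj.
- by move=> x e; case/eqP: (at_ x); apply: ord_inj.
Qed.

Section Prism.
Variables n : nat.

(** Chains of vertices in the prism on the [n]-simplex that lie over all of its
    vertices: the low ones are those before [i + s], the high ones those from [i]
    on.  For [s = true] the vertex [i] occurs on both levels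
    and the chain is an [(n + 1)]-simplex; for [s = false] every vertex occurs
    once and it is an [n]-simplex that crosses the prism. *)
Section Chain.
Variables (s : bool) (i : nat) (le_in : i <= n).

Lemma chain_vertex_lt (t : 'I_(n + s).+1) :
  (if t < i + s then t : nat else t - s) < n.+1.
Proof. case: t => t /= ht; case: s ht; case: ifP; lia. Qed.

Lemma chain_vertex_mono :
  {homo (fun t => Ordinal (chain_vertex_lt t)) : t t' / t <= t'}.
Proof. by move=> t t' /=; case: s t t' => t t' /=; do 2 case: ifP; lia. Qed.

Definition chain_map : dhom (n + s) n := dmk chain_vertex_mono.

Lemma chain_level_mono (t t' : 'I_(n + s).+1) :
  t <= t' -> t' < i + s -> t < i + s.
Proof. exact: leq_ltn_trans. Qed.

Definition chain_level : dhom (n + s) 1 := mklev chain_level_mono.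

Variables (p : nat).

(** The simplex [(g, l)] of the prism has all its vertices on the chain. *)
Definition in_chain (g : dhom p n) (l : dhom p 1) : Prop :=
  forall t, if low l t then g t < i + s else i <= g t.

Lemma chain_mapE (a : dhom p (n + s)) t :
  dcomp chain_map a t = (if a t < i + s then a t : nat else a t - s) :> nat.
Proof. by rewrite dcompE dmkE. Qed.

Lemma chain_levelE (a : dhom p (n + s)) t :
  low (dcomp chain_level a) t = (a t < i + s).
Proof. by rewrite low_comp low_mklev. Qed.

Lemma in_chain_comp (a : dhom p (n + s)) :
  in_chain (dcomp chain_map a) (dcomp chain_level a).
Proof.
move=> t; rewrite chain_levelE chain_mapE; case: ifP => h; rewrite h; lia.
Qed.

Lemma in_chainP (g : dhom p n) (l : dhom p 1) : in_chain g l ->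
  exists a, g = dcomp chain_map a /\ l = dcomp chain_level a.
Proof.
move=> gl.
have lt (t : 'I_p.+1) : (if low l t then g t : nat else g t + s) < (n + s).+1.
  by have := ltn_ord (g t); case: s; case: ifP; lia.
have mon : {homo (fun t => Ordinal (lt t)) : t t' / t <= t'}.
  move=> t t' tt /=; have := dhom_mono g tt; have := @low_le _ l _ _ tt.
  by case: (low l t) (low l t') => [] [] // => [_|/(_ isT)|_] ; lia.
exists (dmk mon); split.
  apply: dhom_ext => t; apply: ord_inj; rewrite chain_mapE dmkE /=.
  by have := gl t; case: ifP => _; case: ifP; lia.
apply: lev_ext => t; rewrite chain_levelE dmkE /=.
by have := gl t; case: ifP => _; lia.
Qed.

Lemma chain_inj (a b : dhom p (n + s)) :
  dcomp chain_map a = dcomp chain_map b ->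
  dcomp chain_level a = dcomp chain_level b -> a = b.
Proof.
move=> eg el; apply: dhom_ext => t; apply: ord_inj.
have := congr1 (fun g : dhom p n => g t : nat) eg.
have := congr1 (fun l => low l t) el.
rewrite !chain_levelE !chain_mapE => e; rewrite -e.
by case: ifP => h; rewrite h in e; lia.
Qed.

End Chain.

(** The index is the last low vertex: low vertices lie at or below it by
    maximality, high ones at or above it because low ones come first. *)
Lemma in_long_chain p (g : dhom p n) (l : dhom p 1) :
  ~ (forall t t', low l t -> low l t' -> g t = g t') ->
  exists z, 0 < g z /\ forall t, if low l t then g t < g z + true else g z <= g t.
Proof.
move=> ncst.
have [z0 lz0] : exists z, low l z.
  by apply: contrapT => h; apply: ncst => t t' lt; case: h; exists t.
have [z lz zmax] := @arg_maxnP _ z0 (fun z => low l z) val lz0.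
exists z; split.
  rewrite lt0n; apply/eqP => e; apply: ncst => t t' lt lt'; apply: ord_inj.
  have := dhom_mono g (zmax t lt); have := dhom_mono g (zmax t' lt').
  by rewrite e; lia.
move=> t; case: (boolP (low l t)) => lt.
  by have := dhom_mono g (zmax t lt); lia.
apply: dhom_mono; rewrite leqNgt; apply/negP => /ltnW/(@low_le _ l)/(_ lz).
exact/negP.
Qed.

Variable k : 'I_n.+1.
Hypothesis kn : 0 < k < n.

(** The filling of the Leibniz product of the horn [k].  First the crossing
    [n]-simplices [(false, q)] are attached, with free face opposite to the
    vertex [k].  The crossing simplices [q] and [q + 1] have faces opposite to
    [k] in common only for [q = k], and there the one with [q = k + 1] is left
    out.  Then come the [(n + 1)]-simplices [(true, i)], by increasing [i].  The
    one with [i = k] has the missing crossing simplex as its free face, the others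
    have the face that lies over the missing face of the horn.  The crossing
    simplices for [q <= 1] and [q = n + 1], and the long one for [i = 0], belong
    to the ends. *)
Definition horn_cell_ok (x : bool * 'I_n.+1) : bool :=
  if x.1 then 0 < x.2 else (1 < x.2) && (x.2 != k.+1 :> nat).

Definition horn_cell := {x : bool * 'I_n.+1 | horn_cell_ok x}.

Definition horn_cell_rank (x : horn_cell) : nat :=
  (sval x).2 + (sval x).1 * n.+1.

Definition horn_cell_dim (x : horn_cell) : nat := n + (sval x).1.

(** The position of the vertex [k] in the chain; on the long chain of index [k],
    where it occurs twice, that of the high occurrence. *)
Definition horn_cell_free_nat (x : horn_cell) : nat :=
  k + ((sval x).1 && ((sval x).2 <= k)).

Lemma horn_cell_free_lt x : horn_cell_free_nat x < (horn_cell_dim x).+1.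
Proof.
rewrite /horn_cell_free_nat /horn_cell_dim.
by case: (sval x).1 => /=; case: leqP; lia.
Qed.

Definition horn_cell_free x : 'I_(horn_cell_dim x).+1 :=
  Ordinal (horn_cell_free_lt x).

Lemma horn_cell_le (x : horn_cell) : (sval x).2 <= n.
Proof. by rewrite -ltnS. Qed.

Notation T := (cyl (empty (simplex n))).
Notation pcls g l := (@cls (simplex n) (empty (simplex n)) _ g l).

Definition horn_filler (x : horn_cell) : T (horn_cell_dim x) :=
  pcls (chain_map (sval x).1 (horn_cell_le x)) (chain_level (sval x).1 (sval x).2).

Lemma horn_filler_act x m (a : dhom m (horn_cell_dim x)) :
  horn_filler x @@ a =
  pcls (dcomp (chain_map (sval x).1 (horn_cell_le x)) a)
       (dcomp (chain_level (sval x).1 (sval x).2) a).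
Proof. exact: cls_act. Qed.

Lemma collapsed_simplex m (g : dhom m n) (l : dhom m 1) :
  @collapsed (simplex n) (empty (simplex n)) m g l <->
  (forall i j, low l i -> low l j -> g i = g j).
Proof.
by rewrite -comp_crush; split=> [[]|e]; [| |right].
Qed.

Lemma horn_filler_in (x : horn_cell) m (g : dhom m n) (l : dhom m 1) :
  in_chain (sval x).1 (sval x).2 g l -> exists a, pcls g l = horn_filler x @@ a.
Proof.
move=> /(in_chainP (horn_cell_le x))[a [-> ->]]; exists a.
by rewrite horn_filler_act.
Qed.

(** A simplex whose projection misses a vertex other than [k] lies over the
    horn. *)
Lemma leibniz_image m (g : dhom m n) (l : dhom m 1) v : v < n.+1 -> v <> k ->
  (forall t, g t <> v :> nat) -> leibniz (horn_incl k) m (pcls g l).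
Proof.
move=> vn vk gv; exists g, l; split=> //; constructor 1.
by exists (exist _ g (horn_miss vn vk gv)).
Qed.

(** Crossing simplices other than the [(k + 1)]-st are in one of the ends or are
    cells.  For [q = 1] there is one low vertex up to repetition, so that the
    simplex is collapsed onto the upper end. *)
Lemma in_short_chain m (g : dhom m n) (l : dhom m 1) (q : nat) (C : Prop) :
  0 < q -> in_chain false q g l ->
  (forall (x : horn_cell), (sval x).1 = false -> (sval x).2 = q :> nat -> C) ->
  q <> k.+1 -> leibniz (horn_incl k) m (pcls g l) \/ C.
Proof.
move=> q0 gl hC qk; have [qn|nq] := leqP q n; last first.
  left; exists g, l; split=> //; constructor 2; apply: botP => t.
  by apply: contraT => nt; have := gl t; rewrite (negPf nt); have := ltn_ord (g t); lia.
have [q1|q1] := leqP q 1; last first.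
  right; have ok : horn_cell_ok (false, Ordinal (qn : q < n.+1)).
    by apply/andP; split=> //; apply/eqP.
  exact: (hC (exist (fun x => horn_cell_ok x) _ ok) erefl erefl).
left; exists g, (top m); split; last by constructor 3.
apply/cls_eq; split=> //; right; split; last exact: collapsed_top.
apply/collapsed_simplex => i j li lj; apply: ord_inj.
by have := gl i; have := gl j; rewrite li lj; lia.
Qed.

(** Leaving out a vertex other than the free one either leaves the projection in
    the horn, or leaves out one of the two occurrences of [i] and so gives a
    crossing simplex; for the [(k + 1)]-st of these, the long cell of index [k]
    contains it. *)
Lemma horn_filler_old x m (a : dhom m (horn_cell_dim x)) :
  in_horn (horn_cell_free x) a ->
  leibniz (horn_incl k) m (horn_filler x @@ a) \/
  exists y, horn_cell_rank y < horn_cell_rank x /\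
    exists b, horn_filler x @@ a = horn_filler y @@ b.
Proof.
move=> /horn_missed[t [tn tk at_]]; rewrite /= in tk.
rewrite /horn_cell_dim in tn a at_ *.
rewrite horn_filler_act.
set g := dcomp _ a; set l := dcomp _ a.
have gE z : g z = (if a z < (sval x).2 + (sval x).1 then a z : nat
    else a z - (sval x).1) :> nat by apply: chain_mapE.
have lE z : low l z = (a z < (sval x).2 + (sval x).1) by apply: chain_levelE.
clearbody g l.
rewrite /horn_cell_free_nat /horn_cell_rank in tk *.
case: x => -[s i] /= ok in a at_ tk tn gE lE *.
case: s ok => /= ok in a at_ tk tn gE lE *; last first.
  left; apply: (@leibniz_image _ _ _ t); [lia|lia|] => z; rewrite gE subn0 if_same.
  exact: at_.
have in_n := ltn_ord i.
have tau (q : nat) : 0 < q -> q <= i.+1 -> in_chain false q g l -> q <> k.+1 ->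
    leibniz (horn_incl k) m (pcls g l) \/ exists y : horn_cell,
      (sval y).2 + (sval y).1 * n.+1 < i + true * n.+1 /\
      exists b, pcls g l = horn_filler y @@ b.
  move=> q0 qi ql qk; apply: (in_short_chain q0 ql _ qk) => y y1 y2.
  exists y; split; first by rewrite y1 y2; have := ltn_ord (sval y).2; lia.
  by apply: horn_filler_in; rewrite y1 y2.
have [ti|ti|ti] := ltngtP t i.
- by apply: or_introl; apply: (@leibniz_image _ _ _ t) => [||z]; [lia|lia|];
    have := at_ z; rewrite gE; case: ifP; lia.
- have [ti1|ti1|ti1] := ltngtP t i.+1; first by lia.
    by apply: or_introl; apply: (@leibniz_image _ _ _ t.-1) => [||z]; [lia|lia|];
      have := at_ z; rewrite gE; case: ifP; lia.
  apply: (tau i.+1) => // [z|]; last by lia.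
  by have := at_ z; rewrite lE gE; case: ifP => h; rewrite ?h; lia.
- have [ik|ik] := EM (i = k.+1 :> nat); last first.
    apply: (tau i) => // z.
    by have := at_ z; rewrite lE gE; case: ifP => h; rewrite ?h; lia.
  (* The crossing simplex that is not a cell is on the long chain of index k. *)
  have okk : horn_cell_ok (true, k) by case/andP: kn.
  right; exists (exist (fun x => horn_cell_ok x) _ okk).
  split; first by rewrite /=; lia.
  apply: horn_filler_in => z /=.
  by have := at_ z; rewrite lE gE; case: ifP => h; rewrite ?h; lia.
Qed.

Section New.
Variables (x : horn_cell) (m : nat) (a : dhom m (horn_cell_dim x)).
Hypothesis na : ~~ in_horn (horn_cell_free x) a.

Let s := (sval x).1.
Let i : nat := (sval x).2.
Let g := dcomp (chain_map s (horn_cell_le x)) a.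
Let l := dcomp (chain_level s i) a.

Lemma horn_cell_okP : if s then 0 < i else (1 < i) && (i != k.+1).
Proof. exact: (svalP x). Qed.

Lemma horn_filler_hit t : t < (n + s).+1 -> t <> horn_cell_free_nat x ->
  exists z, low l z = (t < i + s) /\ g z = (if t < i + s then t else t - s) :> nat.
Proof.
move=> tn tk; have [z az] := hornN_hit na tn tk.
by exists z; rewrite chain_levelE chain_mapE az.
Qed.

(** The chain has two distinct low vertices that are not free: the vertex 0 and
    the last low one, at position [i + s - 1]. *)
Lemma horn_filler_not_collapsed :
  ~ @collapsed (simplex n) (empty (simplex n)) m g l.
Proof.
move=> /collapsed_simplex h; have ok := horn_cell_okP.
have i_n : i <= n := horn_cell_le x.
have [||z0 [l0 g0]] := @horn_filler_hit 0; [lia|rewrite /horn_cell_free_nat; lia|].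
pose v := i + s - 1.
have [||z1 [l1 g1]] := @horn_filler_hit v.
- by move: ok; rewrite /v; case: s; lia.
- by move: ok; rewrite /v /horn_cell_free_nat -/s -/i; case: s => /=; lia.
have := congr1 (@nat_of_ord _) (h z0 z1 _ _).
rewrite l0 l1 g0 g1; move: ok; rewrite /v; case: s => ok; do !case: ifP; lia.
Qed.

Lemma horn_filler_new : ~ leibniz (horn_incl k) m (horn_filler x @@ a).
Proof.
rewrite horn_filler_act => -[c [l' [/cls_eq[e el] h]]].
have {el} el : l = l' by case: el => [//|[/horn_filler_not_collapsed]].
have ok := horn_cell_okP; have i_n : i <= n := horn_cell_le x.
case: h => [[[c' hc'] /= e']|e'|e'].
- have /existsP[v /andP[/eqP vk /forallP gv]] := hc'.
  have {}vk : v <> k :> nat by move=> h; apply: vk; apply: ord_inj.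
  have vn := ltn_ord v.
  pose t := if v < i + s then v : nat else v + s.
  have [||z [_ gz]] := @horn_filler_hit t.
  + by rewrite /t; case: ifP; lia.
  + rewrite /t /horn_cell_free_nat -/s -/i; move: ok vk vn.
    by case: s => /= ok vk vn; case: ifP; lia.
  have /eqP[] := gv z; apply: ord_inj; rewrite -[c']e' -e gz /t.
  by case: (ltnP v (i + s)) => h; rewrite ?h //; case: ifP; lia.
- have [||z [lz _]] := @horn_filler_hit (n + s); first by [].
    by rewrite /horn_cell_free_nat; lia.
  by move: lz; rewrite el e' low_bot; lia.
- have [||z [lz _]] := @horn_filler_hit 0; first by [].
    by rewrite /horn_cell_free_nat; lia.
  by move: lz; rewrite el e' low_top; move: ok; case: s; lia.
Qed.

Lemma horn_filler_cls (g' : dhom m n) (l' : dhom m 1) :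
  horn_filler x @@ a = pcls g' l' -> g = g' /\ l = l'.
Proof.
by rewrite horn_filler_act => /cls_eq[<- [//|[/horn_filler_not_collapsed]]].
Qed.

(** A cell is recognised from any of its simplices outside the horn: the last low
    vertex and the first high one determine the chain, except that for [i = k]
    the first high vertex is the free one and the next has to be used. *)
Lemma horn_filler_distinct y (b : dhom m (horn_cell_dim y)) :
  horn_cell_rank y <= horn_cell_rank x ->
  horn_filler x @@ a = horn_filler y @@ b -> y = x.
Proof.
move=> rk; rewrite (horn_filler_act b) => /horn_filler_cls[eg el].
have : in_chain (sval y).1 (sval y).2 g l.
  by rewrite eg el; apply: in_chain_comp.
have oky : if (sval y).1 then 0 < (sval y).2 else
    (1 < (sval y).2) && ((sval y).2 != k.+1 :> nat).
  exact: (svalP y).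
have ok := horn_cell_okP; have i_n : i <= n := horn_cell_le x.
have y_n := horn_cell_le y.
have [||z1 [l1 g1]] := @horn_filler_hit (i + s - 1).
- by move: ok; case: s; lia.
- by move: ok; rewrite /horn_cell_free_nat -/s -/i; case: s => /=; lia.
have [||z2 [l2 g2]] := @horn_filler_hit (if i == k then (i + s).+1 else i + s).
- by case: ifP; lia.
- by rewrite /horn_cell_free_nat -/s -/i; case: s => /=; case: ifP; lia.
move=> gl; have := gl z1; have := gl z2; rewrite l1 g1 l2 g2 {g1 g2 l1 l2 gl eg el b}.
have -> : i + s - 1 < i + s by move: ok; case: s; lia.
have -> : (if i == k then (i + s).+1 else i + s) < i + s = false by case: ifP; lia.
move=> h2 h1.
suff [yx1 yx2] : (sval y).1 = s /\ (sval y).2 = i :> nat.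
  apply: val_inj; rewrite /= [sval y]surjective_pairing.
  by rewrite [sval x]surjective_pairing; congr pair => //; apply: ord_inj.
move: rk ok oky h1 h2 y_n i_n; rewrite /horn_cell_rank -/s -/i.
move: (sval y).1 (sval y).2 s i => s' i' s0 i0.
by case: s0; case: s' => /= rk ok oky; case: eqP => ik h1 h2 yn inn;
  split=> //; lia.
Qed.

Lemma horn_filler_inj (b : dhom m (horn_cell_dim x)) :
  horn_filler x @@ a = horn_filler x @@ b -> a = b.
Proof. by rewrite (horn_filler_act b) => /horn_filler_cls[]; apply: chain_inj. Qed.

End New.

(** Every simplex that is not collapsed has all its vertices on a long chain. *)
Lemma horn_filler_cover m (w : T m) :
  leibniz (horn_incl k) m w \/ exists x b, w = horn_filler x @@ b.
Proof.
have [g [l ->]] := clsP w.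
have [c|nc] := EM (@collapsed (simplex n) (empty (simplex n)) m g l).
  left; exists g, (top m); split; last by constructor 3.
  by apply/cls_eq; split=> //; right; split=> //; apply: collapsed_top.
have [|z [gz gl]] := @in_long_chain _ g l; first by move/collapsed_simplex.
pose x := exist (fun x => horn_cell_ok x) (true, g z) gz.
by right; exists x; apply: (horn_filler_in (x := x)).
Qed.

End Prism.

Lemma leibS_horn (S : map_class) : saturated S -> contains_inner_horns S ->
  contains_inner_horns (leibS S).
Proof.
move=> satS hornS n k kn; split; first exact: hornS.
apply: (horn_filtration satS hornS (J := horn_cell k) (rk := @horn_cell_rank n k)
  (k := @horn_cell_free n k kn) (c := @horn_filler n k)).
- move=> x; have := horn_cell_okP x; have := horn_cell_le x.
  by rewrite /= /horn_cell_free_nat /horn_cell_dim; case: (sval x).1; lia.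
- by move=> x m a /horn_filler_old.
- by move=> x m a /horn_filler_new.
- by move=> x m a na y b; apply: horn_filler_distinct na _ _.
- by move=> x m a b na _; apply: horn_filler_inj na _.
- by move=> m w; apply: horn_filler_cover.
Qed.



(** * Nondegenerate simplices *)

Lemma miss_factor p n (g : dhom p n) v : (forall t, g t <> v) ->
  exists m, m < n /\ exists (d : dhom m n) (g' : dhom p m), g = dcomp d g'.
Proof.
case: n => [|n] in g v *; first by move/(_ ord0); rewrite !ord1.
move=> gv; exists n; split=> //.
have dm : {homo lift v : i j / i <= j} by move=> i j; rewrite /= /bump; lia.
have lt t : unbump v (g t) < n.+1.
  have : g t <> v :> nat by move=> e; apply: (gv t); apply: ord_inj.
  by have := ltn_ord (g t); have := ltn_ord v; rewrite /unbump; lia.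
have gm : {homo (fun t => Ordinal (lt t)) : i j / i <= j}.
  by move=> i j /(dhom_mono g) /=; rewrite /unbump; lia.
exists (dmk dm), (dmk gm); apply: dhom_ext => t; apply: ord_inj.
have : g t <> v :> nat by move=> e; apply: (gv t); apply: ord_inj.
by rewrite dcompE !dmkE /= /bump /unbump; lia.
Qed.

Definition surj p n (g : dhom p n) : Prop := forall v, exists t, g t = v.

Lemma surj_section p n (g : dhom p n) t0 : surj g ->
  exists d : dhom n p, dcomp g d = did n /\ d (g t0) = t0.
Proof.
move=> gs.
pose f v := if v == g t0 then t0 else sval (cid (gs v)).
have gf v : g (f v) = v.
  by rewrite /f; case: eqP => [->//|_]; apply: (svalP (cid (gs v))).
have fm : {homo f : i j / i <= j}.
  move=> i j ij; rewrite leqNgt; apply/negP => /[dup] lt /ltnW/(dhom_mono g).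
  rewrite !gf => ji; have e : i = j by apply: ord_inj; apply/eqP; rewrite eqn_leq ij.
  by rewrite e ltnn in lt.
exists (dmk fm); split; first by apply: dhom_ext => v; rewrite dcompE dmkE gf didE.
by rewrite dmkE /f eqxx.
Qed.

(** Strictly increasing, hence above the identity from the left end and below it
    from the right end. *)
Lemma inj_endo n (h : dhom n n) : injective h -> h = did n.
Proof.
move=> hi; have hs (i j : 'I_n.+1) : i < j -> h i < h j.
  move=> ij; rewrite ltn_neqAle (dhom_mono h (ltnW ij)) andbT.
  by apply/eqP => /ord_inj/hi e; rewrite e ltnn in ij.
have low m (mn : m < n.+1) : m <= h (Ordinal mn).
  elim: m mn => // m ih mn; apply: leq_ltn_trans (ih (ltnW mn)) _.
  exact: hs.
have up m (mn : n - m < n.+1) : m <= n -> h (Ordinal mn) + m <= n.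
  elim: m mn => [|m ih] mn mn'; first by rewrite addn0 -ltnS.
  have mn2 : n - m < n.+1 by lia.
  have := ih mn2 (ltnW mn'); apply: leq_trans; rewrite addnS -addSn leq_add2r.
  by apply: hs => /=; lia.
apply: dhom_ext => -[m mn]; rewrite didE; apply: ord_inj => /=.
have mn' : n - (n - m) < n.+1 by lia.
have := up (n - m) mn' (leq_subr _ _); have := low m mn.
have -> : Ordinal mn' = Ordinal mn by apply: ord_inj => /=; lia.
by lia.
Qed.

Section Nondegenerate.
Variable X : sset.

(** Nondegeneracy as minimality of the dimension, over all presentations of [x]
    as a restriction of another simplex. *)
Definition nondeg n (x : X n) : Prop :=
  forall m (y : X m) (h : dhom n m), x = y @@ h -> n <= m.

(** If [h] identifies [i < j], then [x] is fixed by the map that sends the interval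
    from [i] to [j] to [i]; that map misses [j], so [x] would come from a lower
    dimension. *)
Lemma nondeg_inj n (x : X n) m (y : X m) (h : dhom n m) :
  nondeg x -> x = y @@ h -> injective h.
Proof.
move=> nx xy.
suff lt (i j : 'I_n.+1) : i < j -> h i <> h j.
  move=> i j e; have [//|ij] := eqVneq i j; case: (ltngtP i j) => [l|l|/ord_inj//].
  - by case: (lt _ _ l e).
  - by case: (lt _ _ l (esym e)).
move=> ij e.
have em : {homo (fun t : 'I_n.+1 => if i <= t <= j then i else t) : a b / a <= b}.
  by move=> a b ab /=; do 2 case: ifP; lia.
have ex : x = x @@ dmk em.
  rewrite xy -actM; congr (_ @@ _); apply: dhom_ext => t.
  rewrite dcompE dmkE; case: ifP => // /andP[it tj]; apply: ord_inj; apply/eqP.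
  by rewrite eqn_leq (dhom_mono h it) e (dhom_mono h tj).
have [|m' [m'n [d [g' eg]]]] := @miss_factor _ _ (dmk em) j.
  by move=> t; rewrite dmkE => /(congr1 (@nat_of_ord _)); case: ifP; lia.
by move: ex; rewrite eg actM => /nx; rewrite leqNgt m'n.
Qed.

Lemma nondeg_dim n (x : X n) m (y : X m) p (g : dhom p n) (h : dhom p m) :
  nondeg x -> surj g -> x @@ g = y @@ h -> n <= m.
Proof.
move=> nx gs e; have [d [gd _]] := surj_section ord0 gs.
by apply: (nx m y (dcomp h d)); rewrite actM -e -actM gd act1.
Qed.

(** Uniqueness in the Eilenberg-Zilber lemma.  For every section [d] of [g], the
    map [h d] is injective by nondegeneracy of [x], hence the identity; letting
    [d] pass through each vertex gives [h = g]. *)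
Lemma nondeg_uniq n (x y : X n) p (g h : dhom p n) :
  nondeg x -> surj g -> x @@ g = y @@ h -> x = y /\ g = h.
Proof.
move=> nx gs e.
have hd d : dcomp g d = did n -> dcomp h d = did n.
  move=> gd; apply: inj_endo; apply: (nondeg_inj (y := y) nx).
  by rewrite actM -e -actM gd act1.
split.
  have [d [gd _]] := surj_section ord0 gs.
  by rewrite -[x]act1 -gd actM e -actM (hd d gd) act1.
apply: dhom_ext => t; have [d [gd dt]] := surj_section t gs.
by rewrite -{2}dt -dcompE (hd d gd) didE.
Qed.

(** Existence in the Eilenberg-Zilber lemma, by taking [n] minimal. *)
Lemma nondeg_exists p (c : X p) :
  exists n (x : X n) (g : dhom p n), [/\ nondeg x, surj g & c = x @@ g].
Proof.
pose P n := `[< exists (x : X n) (g : dhom p n), c = x @@ g >].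
have exP : exists n, P n.
  by exists p; apply/asboolP; exists c, (did p); rewrite act1.
case: (ex_minnP exP) => n /asboolP[x [g cx]] nmin.
exists n, x, g; split=> //.
  move=> m y h xy; apply: nmin; apply/asboolP; exists y, (dcomp h g).
  by rewrite actM -xy.
move=> v; apply: contrapT => nv.
have [|m [mn [d [g' eg]]]] := @miss_factor _ _ g v.
  by move=> t gt; apply: nv; exists t.
suff : n <= m by rewrite leqNgt mn.
by apply: nmin; apply/asboolP; exists (x @@ d), g'; rewrite cx eg actM.
Qed.

End Nondegenerate.


(** * Filling the cylinder over new simplices *)

Section Filling.
Variables (C : sset) (K B : subcx C).
Hypothesis KB : forall n x, K n x -> B n x.
Hypothesis Kvert : forall x : C 0, K 0 x.

Notation W := (cyl K).

(** A simplex crushed along all its vertices is totally degenerate, on a vertex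
    that lies in [K]. *)
Lemma collapsed_bot p (c : C p) : collapsed K c (bot p) -> K p c.
Proof.
case=> // e.
pose v : dhom 0 p := @dmk 0 p (fun=> ord0) (fun _ _ _ => leqnn _).
pose r : dhom p 0 := @dmk p 0 (fun=> ord0) (fun _ _ _ => leqnn _).
have -> : c = c @@ v @@ r.
  rewrite -{1}e -actM; congr (_ @@ _); apply: dhom_ext => t.
  by rewrite crushE low_bot dcompE dmkE.
exact/smem_act/Kvert.
Qed.

Definition fillpred p (c : C p) (l : dhom p 1) : Prop := B p c \/ l = bot p.

Lemma fillpred_act : stable fillpred.
Proof.
by move=> m p a c l [h|->]; [left; apply: smem_act|right; apply: bot_comp].
Qed.

Definition fill_start : subcx W := cyl_sub K fillpred_act.

(** The cells are the long chains of index [pcut] over nondegenerate simplices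
    outside [B].  Index 0 is excluded: that chain has one low vertex and is
    collapsed. *)
Record prism := Prism {
  pdim : nat;
  psimplex : C pdim;
  pcut : nat;
  prism_nondeg : nondeg psimplex;
  prism_notin : ~ B pdim psimplex;
  pcut_bound : 0 < pcut <= pdim
}.

Lemma prism_eq (x : prism) (c : C (pdim x)) i nd nB ib :
  psimplex x = c -> pcut x = i -> @Prism (pdim x) c i nd nB ib = x.
Proof.
case: x c nd nB ib => n c i0 nd0 nB0 ib0 c' nd nB ib /= ec ei; subst c' i.
by congr Prism; apply: Prop_irrelevance.
Qed.

Lemma pcut_le (x : prism) : pcut x <= pdim x.
Proof. by case/andP: (pcut_bound x). Qed.

(** Lexicographic order on the dimension [n] and then on decreasing [i]: since
    [1 <= i <= n], the ranks for [n] lie between [n ^ 2] and [n ^ 2 + n - 1]. *)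
Definition prism_rank (x : prism) : nat := pdim x * pdim x + pdim x - pcut x.

Lemma prism_free_lt (x : prism) : pcut x < (pdim x + true).+1.
Proof. by have := pcut_le x; lia. Qed.

Definition prism_free (x : prism) : 'I_(pdim x + true).+1 :=
  Ordinal (prism_free_lt x).

Definition prism_filler (x : prism) : W (pdim x + true) :=
  cls K (psimplex x @@ chain_map true (pcut_le x)) (chain_level (pdim x) true (pcut x)).

Lemma prism_filler_act x m (a : dhom m (pdim x + true)) :
  prism_filler x @@ a =
  cls K (psimplex x @@ dcomp (chain_map true (pcut_le x)) a)
        (dcomp (chain_level (pdim x) true (pcut x)) a).
Proof. by rewrite cls_act actM. Qed.

Lemma prism_filler_in (x : prism) m (g : dhom m (pdim x)) (l : dhom m 1) :
  in_chain true (pcut x) g l ->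
  exists a, cls K (psimplex x @@ g) l = prism_filler x @@ a.
Proof.
move=> /(in_chainP (pcut_le x))[a [-> ->]]; exists a.
by rewrite prism_filler_act.
Qed.

(** A pair that is not collapsed lies on the chain whose index is its last low
    vertex.  A collapsed one may be given any other level for which it is
    collapsed; taking as low those vertices that lie over 0 puts it on the chain
    of index 1. *)
Lemma nondeg_cover n (x : C n) p (h : dhom p n) (l : dhom p 1) :
  nondeg x -> ~ B n x ->
  exists y : prism, prism_rank y < n * n + n /\
    exists a, cls K (x @@ h) l = prism_filler y @@ a.
Proof.
move=> nx nB.
have n0 : 0 < n.
  by case: n x {h} nx nB => // x _ nB; case: nB; apply: KB.
suff [i [l' [ib il e]]] : exists i l',
    [/\ 0 < i <= n, in_chain true i h l' & cls K (x @@ h) l = cls K (x @@ h) l'].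
  exists (@Prism n x i nx nB ib); split; first by rewrite /prism_rank /=; lia.
  have [a ea] := @prism_filler_in (@Prism n x i nx nB ib) _ _ _ il.
  by exists a; rewrite e.
have [cl|ncl] := EM (collapsed K (x @@ h) l).
  have bm (t t' : 'I_p.+1) : t <= t' -> h t' == ord0 -> h t == ord0.
    move=> tt' /eqP h0; apply/eqP/ord_inj/eqP; rewrite -leqn0.
    by have := dhom_mono h tt'; rewrite h0.
  exists 1, (mklev bm); split=> //.
    move=> t; rewrite low_mklev; case: ifP => [/eqP->//|/negbT ht].
    by rewrite lt0n; apply: contra ht => /eqP e; apply/eqP/ord_inj.
  apply/cls_eq; split=> //; right; split=> //; right.
  rewrite -actM; congr (_ @@ _); apply/comp_crush => t t'.
  by rewrite !low_mklev => /eqP-> /eqP->.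
have ncst : ~ (forall i j, low l i -> low l j -> h i = h j).
  by move=> /comp_crush e; apply: ncl; right; rewrite -actM e.
have [z [hz hl]] := in_long_chain ncst.
by exists (h z), l; split=> //; rewrite hz -ltnS ltn_ord.
Qed.

(** Leaving out a vertex other than the low [i] either makes the projection
    factor through a lower dimension, where [nondeg_cover] applies to smaller
    ranks, or leaves out the high [i].  The latter face is on the chain of index
    [i + 1], and is in the lower end if [i = n]. *)
Lemma prism_filler_old x m (a : dhom m (pdim x + true)) :
  in_horn (prism_free x) a ->
  fill_start m (prism_filler x @@ a) \/
  exists y, prism_rank y < prism_rank x /\
    exists b, prism_filler x @@ a = prism_filler y @@ b.
Proof.
move=> /horn_missed[t [tn tk at_]]; rewrite /= in tk.
rewrite prism_filler_act.
set g := dcomp _ a; set l := dcomp _ a.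
have gE z : g z = (if a z < pcut x + true then a z : nat
    else a z - true) :> nat by apply: chain_mapE.
have lE z : low l z = (a z < pcut x + true) by apply: chain_levelE.
have ib := pcut_bound x.
have [ti|ti] := EM (t = (pcut x).+1); last first.
  have [v gv] : exists v, forall z, g z <> v.
    have vn : (if t < pcut x then t else t.-1) < (pdim x).+1.
      by case: ifP; lia.
    exists (Ordinal vn) => z /(congr1 (@nat_of_ord _)); rewrite gE [RHS]/=.
    by have := at_ z; case: ifP; case: ifP; lia.
  have [m' [m'n [d [g' eg]]]] := miss_factor gv.
  have [q [y [h [ny hs e]]]] := nondeg_exists (psimplex x @@ g).
  have qm : q <= m'.
    apply: (nondeg_dim (y := psimplex x @@ d) (h := g') ny hs).
    by rewrite -e eg actM.
  have [yB|nyB] := EM (B q y).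
    left; exists (psimplex x @@ g), l; split=> //; left.
    by rewrite e; apply: smem_act.
  right; have [X [rX [b eb]]] := nondeg_cover h l ny nyB.
  exists X; split; last by exists b; rewrite e.
  by apply: leq_trans rX _; rewrite /prism_rank; nia.
have [ilt|ige] := ltnP (pcut x) (pdim x); last first.
  left; exists (psimplex x @@ g), l; split=> //; right; apply: botP => z.
  by rewrite lE; have := at_ z; have := ltn_ord (a z); lia.
have ib' : 0 < (pcut x).+1 <= pdim x by [].
pose y := @Prism (pdim x) (psimplex x) (pcut x).+1
  (@prism_nondeg x) (@prism_notin x) ib'.
right; exists y; split; first by rewrite /prism_rank /=; lia.
apply: (@prism_filler_in y) => z /=; rewrite lE gE.
by have := at_ z; case: ifP => h; rewrite ?h; lia.
Qed.

Section New.
Variables (x : prism) (m : nat) (a : dhom m (pdim x + true)).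
Hypothesis na : ~~ in_horn (prism_free x) a.

Let i := pcut x.
Let g := dcomp (chain_map true (pcut_le x)) a.
Let l := dcomp (chain_level (pdim x) true i) a.

Lemma prism_filler_hit t : t < (pdim x).+2 -> t <> i ->
  exists z, low l z = (t <= i) /\ g z = (if t <= i then t else t.-1) :> nat.
Proof.
move=> tn tk; have [|z az] := hornN_hit na _ tk; first by lia.
by exists z; rewrite chain_levelE chain_mapE az addn1 ltnS subn1.
Qed.

Lemma prism_filler_surj : surj g.
Proof.
move=> v; have ib := pcut_bound x; have vn := ltn_ord v.
have [||z [_ gz]] := @prism_filler_hit (if v < i then v : nat else v.+1).
- by case: ifP; lia.
- by rewrite /i; case: ifP; lia.
exists z; apply: ord_inj; rewrite gz; case: (ltnP v i) => vi; first by rewrite ltnW.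
by rewrite leqNgt ltnS vi.
Qed.

Lemma prism_filler_notin : ~ B m (psimplex x @@ g).
Proof.
have [d [gd _]] := surj_section ord0 prism_filler_surj.
by move=> /(smem_act d); rewrite -actM gd act1; apply: prism_notin.
Qed.

(** Over a nondegenerate simplex outside [B], only the pairs that are constant
    along the low vertices are collapsed, by uniqueness in the Eilenberg-Zilber
    lemma. *)
Lemma prism_filler_const (l' : dhom m 1) : collapsed K (psimplex x @@ g) l' ->
  forall s t, low l' s -> low l' t -> g s = g t.
Proof.
case=> [/KB/prism_filler_notin//|]; rewrite -actM => e; apply/comp_crush/esym.
by have [] := nondeg_uniq (@prism_nondeg x) prism_filler_surj (esym e).
Qed.

Lemma prism_filler_zero : exists z, low l z /\ g z = 0 :> nat.
Proof.
have [||z] := @prism_filler_hit 0; first by [].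
  by have := pcut_bound x; rewrite /i; lia.
by exists z.
Qed.

Lemma prism_filler_new : ~ fill_start m (prism_filler x @@ a).
Proof.
rewrite prism_filler_act => -[c [l' [/cls_eq[<- e] [/prism_filler_notin//|lb]]]].
rewrite {}lb in e; case: e => [e|[_ /collapsed_bot/KB/prism_filler_notin//]].
have [||z [lz _]] := @prism_filler_hit (pdim x).+1; first by [].
  by have := pcut_bound x; rewrite /i; lia.
by move: lz; rewrite /l e low_bot; have := pcut_bound x; rewrite /i; lia.
Qed.

(** The projection determines the underlying simplex, so the other cell would have
    the same simplex and a larger index [i'].  If the levels agree, the high
    vertex [i] contradicts [i < i'].  If both pairs are collapsed, the vertices 0
    and 1 are both low for the other level because [1 < i'], and distinct. *)
Lemma prism_filler_distinct y (b : dhom m (pdim y + true)) :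
  prism_rank y <= prism_rank x ->
  prism_filler x @@ a = prism_filler y @@ b -> y = x.
Proof.
move=> rk; rewrite !prism_filler_act => /cls_eq[].
have ib := pcut_bound x; have := pcut_bound y.
rewrite -/g -/i -/l.
case: y b rk => n' x' i' nx' nB' ib' /= b; rewrite /prism_rank /= => rk _ e el.
have le_n : pdim x <= n' := nondeg_dim (@prism_nondeg x) prism_filler_surj e.
have en : n' = pdim x.
  by apply/eqP; rewrite eqn_leq le_n andbT leqNgt; apply/negP; nia.
subst n'; have [ex eg] := nondeg_uniq (@prism_nondeg x) prism_filler_surj e.
apply: prism_eq ex _; apply/eqP; rewrite eqn_leq; apply/andP; split; first by lia.
rewrite leqNgt; apply/negP => ii'.
have gl' : in_chain true i' g (dcomp (chain_level (pdim x) true i') b).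
  by rewrite eg; apply: in_chain_comp.
case: el => [el|[cl cl']].
  have [||z [lz gz]] := @prism_filler_hit i.+1; [lia|lia|].
  by have := gl' z; rewrite -el lz gz ltnn leqNgt ii'.
have cst := prism_filler_const cl'.
have [z0 [_ g0]] := prism_filler_zero.
have n1 : 1 < (pdim x).+1 by lia.
have [z1 g1] := prism_filler_surj (Ordinal n1).
have lo' z : g z <= 1 -> low (dcomp (chain_level (pdim x) true i') b) z.
  by move=> gz; have := gl' z; case: ifP => // _; lia.
have e01 : g z0 = g z1 by apply: cst; apply: lo'; rewrite ?g0 ?g1.
by move/(congr1 (@nat_of_ord _)): e01; rewrite g0 g1.
Qed.

(** A collapsed simplex of the cell outside the horn is a degeneracy of the free
    face of the chain of index 1; its level is then determined by its
    projection, which gives injectivity on collapsed simplices as well. *)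
Lemma prism_filler_low :
  collapsed K (psimplex x @@ g) l -> forall z, low l z = (g z == ord0).
Proof.
move=> /prism_filler_const cst; have [z0 [l0 g0]] := prism_filler_zero.
have gE z : g z = (if a z < i + true then a z : nat else a z - true) :> nat.
  exact: chain_mapE.
have lE z : low l z = (a z < i + true) by apply: chain_levelE.
have ib := pcut_bound x.
move=> z; apply/idP/eqP => [lz|gz].
  by rewrite (cst z z0) //; apply: ord_inj.
rewrite lE; have := congr1 (@nat_of_ord _) gz; rewrite gE [RHS]/=.
by case: ifP => // az; rewrite /i in az *; lia.
Qed.

End New.

Lemma prism_filler_inj x m (a b : dhom m (pdim x + true)) :
  ~~ in_horn (prism_free x) a -> ~~ in_horn (prism_free x) b ->
  prism_filler x @@ a = prism_filler x @@ b -> a = b.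
Proof.
move=> na nb; rewrite !prism_filler_act => /cls_eq[e el].
have [_ eg] := nondeg_uniq (@prism_nondeg x) (prism_filler_surj na) e.
apply: (chain_inj eg); case: el => [//|[ca cb]]; apply: lev_ext => z.
by rewrite (prism_filler_low na ca) eg; rewrite -(prism_filler_low nb) // -eg.
Qed.

Lemma prism_filler_cover m (w : W m) :
  fill_start m w \/ exists x b, w = prism_filler x @@ b.
Proof.
have [c [l ->]] := clsP w; have [n [x [g [nx gs ->]]]] := nondeg_exists c.
have [xB|nxB] := EM (B n x).
  by left; exists (x @@ g), l; split=> //; left; apply: smem_act.
by right; have [y [_ h]] := nondeg_cover g l nx nxB; exists y.
Qed.

Lemma fill_anodyne (S : map_class) : saturated S -> contains_inner_horns S ->
  incl_in S fill_start (full W).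
Proof.
move=> satS hornS.
apply: (horn_filtration satS hornS (J := prism) (rk := prism_rank)
  (k := prism_free) (c := prism_filler)).
- by move=> x; have := pcut_bound x; rewrite /=; lia.
- by move=> x m a; apply: prism_filler_old.
- by move=> x m a; apply: prism_filler_new.
- by move=> x m a na y b; apply: prism_filler_distinct.
- by move=> x m a b; apply: prism_filler_inj.
- by move=> m w; apply: prism_filler_cover.
Qed.

End Filling.

(** * The theorem *)

Section Main.
Variable S : map_class.
Hypotheses (satS : saturated S) (hornS : contains_inner_horns S).
Variables (A B C : sset) (i : smap A B) (j : smap B C).
Hypothesis ji_inner : inner_anodyne (scomp j i).
Hypothesis i_inner : inner_anodyne i.
Hypothesis j_mono : mono j.

Let K := image (scomp j i).
Notation W := (cyl K).

Lemma K_vertices (x : C 0) : K 0 x.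
Proof.
have [_ h] := ji_inner (vertS_saturated satS) (vertS_horn hornS).
exact: h.
Qed.

Definition cyl_top : smap C W.
Proof.
refine (@SMap C W (fun p c => cls K c (top p)) _).
by move=> m p a c; rewrite cls_act top_comp.
Defined.

Definition cyl_bot : smap C W.
Proof.
refine (@SMap C W (fun p c => cls K c (bot p)) _).
by move=> m p a c; rewrite cls_act bot_comp.
Defined.

Lemma cls_fst p (c : C p) l : (sval (cls K c l)).1 = c.
Proof. by have /normalize_eq[] := normalizeK (normalize K c l). Qed.

Definition cyl_proj : smap W C.
Proof.
refine (@SMap W C (fun p w => (sval w).1) _).
by move=> m p a w; have [c [l ->]] := clsP w; rewrite cls_act !cls_fst.
Defined.

(** The stage of [W] made of [B] on level 1 and [C] on level 0.  Simplices of [K] are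
    allowed with any level, since they all represent [(c, 1)]. *)
Definition endpred p (c : C p) (l : dhom p 1) : Prop :=
  [\/ K p c, image j p c /\ l = top p | l = bot p].

Lemma endpred_act : stable endpred.
Proof.
move=> m p a c l [h|[h ->]|->]; [constructor 1|constructor 2|constructor 3].
- exact: smem_act.
- by split; [apply: smem_act|apply: top_comp].
- exact: bot_comp.
Qed.

(** The three steps are a pushout of [j i] along [c |-> (c, 0)], a pushout of the
    Leibniz product of [i], and the filling over the simplices outside [B]. *)
Lemma S_cyl_top : S (scomp cyl_top j).
Proof.
have j_inj := mono_inj j_mono.
have Kj p c : K p c -> image j p c by move=> [a ->]; exists (i p a).
have bot_K p (c : C p) : collapsed K c (bot p) -> K p c.
  exact: (collapsed_bot K_vertices).
apply: (incl_in_mono satS).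
  by move=> n x y /cls_eq[/j_inj].
apply: (incl_in_trans satS (V := cyl_sub K endpred_act)).
  apply: (incl_in_pushout satS (f := scomp j i) (g := cyl_bot)).
  - exact: ji_inner.
  - by move=> n w [b ->]; exists (j n b), (top n); split=> //; constructor 2;
      split=> //; exists b.
  - by move=> n c; exists c, (bot n); split=> //; constructor 3.
  - move=> n w [c [l [-> [Kc|[[b ->] ->]|->]]]].
    + left; have [b cb] := Kj _ _ Kc; exists b; rewrite /= -cb.
      by apply/cls_eq; split=> //; right; split; left.
    + by left; exists b.
    + by right; exists c.
  - move=> n c; split=> [[b /cls_eq[-> [/bot_top//|[/bot_K]]]] //|Kc].
    have [b cb] := Kj _ _ Kc; exists b; rewrite /= -cb.
    by apply/cls_eq; split=> //; right; split; left.
  - by move=> n c c' /cls_eq[]; left.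
apply: (incl_in_trans satS (V := cyl_sub K (@fillpred_act C (image j)))).
  apply: (incl_in_cyl satS (f := i) (g := j)).
  - exact: (i_inner (leibS_saturated satS) (leibS_horn satS hornS)).
  - by move=> p b [a /j_inj ->]; exists a.
  - by move=> p b b' /j_inj; left.
  - by move=> p c l [/Kj|[h _]|h]; [left|left|right].
  - by move=> p b l; left; exists b.
  - by move=> p c l [h|h]; [right|left; constructor 3].
  - move=> p b l; split=> [[[a /j_inj ->]|[_ h]|h]|[[a ->]|h|h]].
    + by constructor 1; exists a.
    + by constructor 3.
    + by constructor 2.
    + by constructor 1; exists a.
    + by constructor 3.
    + by constructor 2; split=> //; exists b.
exact: (fill_anodyne Kj K_vertices satS hornS).
Qed.

Lemma S_j : S j.
Proof.
apply: (saturated_retract satS) S_cyl_top.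
exists (sid B), (sid B), cyl_top, cyl_proj.
by split; apply: smap_ext => n x //=; rewrite cls_fst.
Qed.

End Main.

Theorem theorem1p5 (A B C : sset) (i : smap A B) (j : smap B C) :
  mono i -> mono j ->
  inner_anodyne i -> inner_anodyne (scomp j i) -> inner_anodyne j.
Proof.
move=> _ mj ai aji S satS hornS.
exact: (S_j satS hornS aji ai mj).
Qed.
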